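(* Let $f\in\Phi_{\times}'(\mathbb{R}^n)$, let $\rho(t)$, $t>0$, be an automodel function, let $g\in\Phi_{\times}'(\mathbb{R}^n)$, and let $\beta=(\beta_1,\dots,\beta_n)\in\mathbb{C}^n$, with $|\beta|=\beta_1+\cdots+\beta_n$ (so $|-\beta|=-\beta_1-\cdots-\beta_n$). Then $$f(x)\stackrel{\Phi_{\times}'}{\sim}g(x),\quad|x|\to\infty\quad\big(\rho(t)\big)$$ if and only if $$D^{\beta}_{\times}f(x)\stackrel{\Phi_{\times}'}{\sim}D^{\beta}_{\times}g(x),\quad|x|\to\infty\quad\big(t^{|-\beta|}\rho(t)\big).$$
   Context: Fourier transform: $F[\varphi](\xi)=\int_{\mathbb{R}^n}e^{i\xi\cdot x}\varphi(x)\,d^nx$ for $\varphi$ in the Schwartz space $\mathcal{S}(\mathbb{R}^n)$. Lizorkin spaces of the second type: $\Psi_\times(\mathbb{R}^n)$ is the set of $\psi\in\mathcal{S}(\mathbb{R}^n)$ such that $(\partial^{j}_\xi\psi)(\xi_1,\dots,\xi_{k-1},0,\xi_{k+1},\dots,\xi_n)=0$ for all $k=1,\dots,n$ and all multi-indices $j$ with $|j|=0,1,2,\dots$; and $\Phi_\times(\mathbb{R}^n)=\{F[\psi]:\psi\in\Psi_\times(\mathbb{R}^n)\}$, with the topology of $\mathcal{S}(\mathbb{R}^n)$. Equivalently, $\phi\in\Phi_\times(\mathbb{R}^n)$ iff $\phi\in\mathcal{S}(\mathbb{R}^n)$ and $\int_{-\infty}^{\infty}x_k^m\phi(x_1,\dots,x_n)\,dx_k=0$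 for all $m=0,1,2,\dots$, $k=1,\dots,n$ and all values of the other variables. $\Phi_\times'(\mathbb{R}^n)$ is the space of continuous linear functionals on $\Phi_\times(\mathbb{R}^n)$, with (weak) convergence tested on each element of $\Phi_\times(\mathbb{R}^n)$. For $f\in\Phi_\times'(\mathbb{R}^n)$ and $t>0$, $\langle f(tx),\phi(x)\rangle=t^{-n}\langle f(x),\phi(x/t)\rangle$. Multi-Riesz fractional operator: for $\alpha\in\mathbb{C}^n$ let $f_\alpha(x)=\kappa_{\alpha_1}(x_1)\times\cdots\times\kappa_{\alpha_n}(x_n)$ (direct product), where $\kappa_{a}$, $a\in\mathbb{C}$, is the one-dimensional Riesz kernel: $\kappa_a(y)=\dfrac{|y|^{a-1}\Gamma(\frac{1-a}{2})}{2^{a}\sqrt{\pi}\,\Gamma(\frac a2)}$ for $a\neq-2s,\ 1+2s$ ($|y|^{a-1}$ being defined by analytic continuation in $a$), $\kappa_{1+2s}(y)=(-1)^{s+1}\dfrac{|y|^{2s}\log|y|}{\pi(2s)!}$, and $\kappa_{-2s}(y)=(-1)^s\delta^{(2s)}(y)$, $s=0,1,2,\dots$. For $\phi\in\Phi_\times(\mathbb{R}^n)$, $D^{\beta}_\times\phi=f_{-\beta}*\phi$; equivalently, $D^\beta_\times\phi=F^{-1}\big[\prod_{j=1}^n|\xi_j|^{\beta_j}F[\phi](\xi)\big]$. The operator $D^\beta_\times$ maps $\Phi_\times(\mathbb{R}^n)$ onto itself. For $f\in\Phi_\times'(\mathbb{R}^n)$, $D^{\beta}_\times f$ is defined by $\langle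 D^{\beta}_\times f,\phi\rangle=\langle f,D^{\beta}_\times\phi\rangle$ for all $\phi\in\Phi_\times(\mathbb{R}^n)$. Automodel (regularly varying) function of degree $\alpha\in\mathbb{R}$: a positive continuous function $\rho$ on $(0,\infty)$ such that $\lim_{t\to\infty}\rho(ta)/\rho(t)=a^{\alpha}$ for every $a>0$; an automodel function is one of some degree $\alpha\in\mathbb{R}$. Quasi-asymptotics at infinity: $f(x)\stackrel{\Phi_\times'}{\sim}g(x)$, $|x|\to\infty$ $(\rho(t))$, means that $f(tx)/\rho(t)\to g(x)$ in $\Phi_\times'(\mathbb{R}^n)$ as $t\to\infty$, with $g\not\equiv0$ in $\Phi'_\times(\mathbb{R}^n)$. The same notation and definition are used with the (possibly complex-valued) normalizing function $t^{|-\beta|}\rho(t)$ in place of $\rho(t)$. *)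

(* Defs.v *)
From HB Require Import structures.
From mathcomp Require Import all_boot all_order all_algebra complex.
From mathcomp Require Import all_classical all_reals all_analysis.

Set Implicit Arguments.
Unset Strict Implicit.
Unset Printing Implicit Defensive.

Import Order.TTheory GRing.Theory Num.Theory.
Import numFieldNormedType.Exports.

Local Open Scope classical_set_scope.
Local Open Scope ring_scope.
Local Open Scope complex_scope.

Definition expi (R : realType) (u : R) : R[i] := cos u +i* sin u.

(* The principal power t^z = e^{z ln t} of t > 0. At t = 0, where
   [ln 0 = 0], the value is a convention: cpow 0 z multiplies only values
   that vanish. *)
Definition cpow (R : realType) (t : R) (z : R[i]) : R[i] :=
  (expR (complex.Re z * ln t))%:C * expi (complex.Im z * ln t).

(* The real derivative of a complex-valued function of a real vector is taken
   on the real and imaginary parts, R[i] being a normed space over R[i] and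
   not over R in the library. *)
Definition partial (R : realType) (n : nat) (k : 'I_n) (f : 'rV[R]_n -> R[i]) :
    'rV[R]_n -> R[i] := fun x =>
  'D_(delta_mx 0 k) (@complex.Re R \o f) x +i* 'D_(delta_mx 0 k) (@complex.Im R \o f) x.

Definition partial_derivable (R : realType) (n : nat) (k : 'I_n)
    (f : 'rV[R]_n -> R[i]) (x : 'rV[R]_n) : Prop :=
  derivable (@complex.Re R \o f) x (delta_mx 0 k) /\
  derivable (@complex.Im R \o f) x (delta_mx 0 k).

(* The mixed partial derivative along a word of directions. On smooth functions
   the order of the letters is immaterial, and the words with j_k letters k
   give the derivative of multi-index j. *)
Definition partials (R : realType) (n : nat) (s : seq 'I_n)
    (f : 'rV[R]_n -> R[i]) : 'rV[R]_n -> R[i] :=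
  foldr (@partial R n) f s.

(* R[i]^o is R[i] with its normed topology. *)
Definition smooth (R : realType) (n : nat) (f : 'rV[R]_n -> R[i]) : Prop :=
  forall s : seq 'I_n,
    continuous (partials s f : 'rV[R]_n -> R[i]^o) /\
    forall (k : 'I_n) (x : 'rV[R]_n), partial_derivable k (partials s f) x.

(* Every derivative of order at most N is bounded by e (1 + |x|)^(- N), that is,
   the N-th norm of the usual increasing family defining the topology of the
   Schwartz space is at most e. Here |x| is the sup norm of R^n. *)
Definition schwartz_norm_le (R : realType) (n N : nat) (f : 'rV[R]_n -> R[i])
    (e : R) : Prop :=
  forall s : seq 'I_n, (size s <= N)%N ->
  forall x : 'rV[R]_n, ((1 + `|x|) ^+ N)%:C * `|partials s f x| <= e%:C.

Definition schwartz (R : realType) (n : nat) : set ('rV[R]_n -> R[i]) :=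
  [set f | smooth f /\ forall N : nat, exists M : R, schwartz_norm_le N f M].

Definition cintegral (R : realType) (f : R -> R[i]) : R[i] :=
  Rintegral lebesgue_measure setT (@complex.Re R \o f) +i*
  Rintegral lebesgue_measure setT (@complex.Im R \o f).

(* The integral over R^n, iterated over the coordinates. By Fubini's theorem
   it is the Lebesgue integral for the rapidly decreasing continuous functions
   to which it is applied. *)
Fixpoint integral_rV (R : realType) (n : nat) : ('rV[R]_n -> R[i]) -> R[i] :=
  match n return ('rV[R]_n -> R[i]) -> R[i] with
  | 0 => fun f => f 0
  | m.+1 => fun f =>
      cintegral (fun u : R =>
        integral_rV (fun v : 'rV[R]_m => f (row_mx (u%:M : 'rV[R]_1) v)))
  end.

Definition dotp (R : realType) (n : nat) (x y : 'rV[R]_n) : R :=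
  \sum_(k < n) x 0 k * y 0 k.

Definition fourier (R : realType) (n : nat) (f : 'rV[R]_n -> R[i]) :
    'rV[R]_n -> R[i] :=
  fun xi => integral_rV (fun x => expi (dotp xi x) * f x).

Definition inv_fourier (R : realType) (n : nat) (f : 'rV[R]_n -> R[i]) :
    'rV[R]_n -> R[i] :=
  fun x => ((2 * pi) ^- n)%:C * integral_rV (fun xi => expi (- dotp xi x) * f xi).

Definition Psi_times (R : realType) (n : nat) : set ('rV[R]_n -> R[i]) :=
  [set psi | schwartz psi /\
    forall (k : 'I_n) (s : seq 'I_n) (xi : 'rV[R]_n),
      xi 0 k = 0 -> partials s psi xi = 0].

Definition Phi_times (R : realType) (n : nat) : set ('rV[R]_n -> R[i]) :=
  @fourier R n @` @Psi_times R n.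

(* An element of the dual of Phi_times is given by a map on all functions of
   which only the restriction to Phi_times matters. *)
Definition functional (R : realType) (n : nat) : Type :=
  ('rV[R]_n -> R[i]) -> R[i].

Definition linear_on_Phi (R : realType) (n : nat) (f : functional R n) : Prop :=
  forall (a : R[i]) (phi1 phi2 : 'rV[R]_n -> R[i]),
    Phi_times phi1 -> Phi_times phi2 ->
    f (fun x => a * phi1 x + phi2 x) = a * f phi1 + f phi2.

Definition continuous_on_Phi (R : realType) (n : nat) (f : functional R n) :
    Prop :=
  forall phi0 : 'rV[R]_n -> R[i], Phi_times phi0 ->
  forall e : R, 0 < e -> exists (N : nat) (d : R), 0 < d /\
    forall phi : 'rV[R]_n -> R[i], Phi_times phi ->
      schwartz_norm_le N (fun x => phi x - phi0 x) d ->
      `|f phi - f phi0| <= e%:C.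

Definition Phi_dual (R : realType) (n : nat) : set (functional R n) :=
  [set f | linear_on_Phi f /\ continuous_on_Phi f].

(* Convolution with the product of the one-dimensional Riesz kernels of orders
   - beta_k, through the Fourier transform of these kernels. The Fourier
   transform of an element of Phi_times vanishes where some xi_k is 0. *)
Definition multi_riesz (R : realType) (n : nat) (beta : 'rV[R[i]]_n)
    (phi : 'rV[R]_n -> R[i]) : 'rV[R]_n -> R[i] :=
  inv_fourier (fun xi =>
    (\prod_(k < n) cpow `|xi 0 k| (beta 0 k)) * fourier phi xi).

Definition dual_multi_riesz (R : realType) (n : nat) (beta : 'rV[R[i]]_n)
    (f : functional R n) : functional R n :=
  fun phi => f (multi_riesz beta phi).

(* <f(t x), phi(x)> = t^(- n) <f(x), phi(x / t)>, for t > 0. *)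
Definition dual_dilation (R : realType) (n : nat) (t : R) (f : functional R n) :
    functional R n :=
  fun phi => (t ^- n)%:C * f (fun x => phi (t^-1 *: x)).

Definition automodel_of_degree (R : realType) (alpha : R) (rho : R -> R) : Prop :=
  [/\ forall t : R, 0 < t -> 0 < rho t,
      {within `]0, +oo[, continuous rho} &
      forall a : R, 0 < a -> rho (t * a) / rho t @[t --> +oo] --> a `^ alpha].

Definition automodel (R : realType) (rho : R -> R) : Prop :=
  exists alpha : R, automodel_of_degree alpha rho.

Definition quasi_asymptotic (R : realType) (n : nat) (f g : functional R n)
    (c : R -> R[i]) : Prop :=
  (exists2 phi, Phi_times phi & g phi <> 0) /\
  forall phi, Phi_times phi ->
    (dual_dilation t f phi / c t : R[i]^o) @[t --> +oo] --> (g phi : R[i]^o).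

(* Main.v *)
Require Import Defs.
From mathcomp Require Import all_boot all_order all_algebra complex.
From mathcomp Require Import all_classical all_reals all_analysis.
From mathcomp Require Import measurable_realfun ring lra.
Set Implicit Arguments.
Unset Strict Implicit.
Unset Printing Implicit Defensive.
Import Order.TTheory GRing.Theory Num.Theory.
Import numFieldNormedType.Exports.
Local Open Scope classical_set_scope.
Local Open Scope ring_scope.
Local Open Scope complex_scope.

(** In Fourier variables a test function is [F psi] with [psi] in [Psi_times],
and the inversion formula [F (F psi) x = (2 pi)^n psi (- x)]
([fourier_inversion]) turns the operator into a multiplication:
[D^beta (F psi) = F (m psi)], where [m xi] is the product of the powers
[|xi_k|^beta_k] ([multi_riesz_fourier]). Three facts follow.

Multiplication by [m] maps [Psi_times] to itself ([Psi_multiplier]), and its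
inverse is the multiplication associated with [- beta]; hence [D^beta] maps the
test space onto itself ([multi_riesz_surj]). As [m] is homogeneous of degree
[|beta|], the operator commutes with the dilation [x |-> x / t] up to the factor
[t^(- |beta|)] ([multi_riesz_dilation]). By linearity of [f], the quotient whose
limit defines the quasi-asymptotics of [D^beta f], tested on [phi], is then for
every [t > 0] the quotient for [f] tested on [D^beta phi]
([cvg_dual_multi_riesz]). Since [D^beta phi] ranges over all test functions, the
two families of limits are the same, and so are the conditions that [g] and
[D^beta g] are not zero.

Inversion in one variable is obtained by damping with [e^(- e |xi|)], whose
Fourier transform is the Poisson kernel, and letting [e] tend to 0
([fourier1_inversion]). In several variables it follows by induction on the
dimension: the transform in the first variable alone keeps a Schwartz function
in the Schwartz space of the other variables ([schwartz_fourier_head]), and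
Fubini's theorem relates it to the full transform ([fourier_cons]).

The factor [|xi_k|^b] is singular where [xi_k = 0]. An element of [Psi_times]
vanishes there to infinite order, with rapid decrease along the hyperplane
([Psi_flat]), and this absorbs every power of [1 / |xi_k|] produced by
differentiation. That a new function is in the Schwartz space or in [Psi_times] is
proved by exhibiting a set of functions that is stable under partial derivatives
([schwartz_coinduction], [Psi_coinduction]). *)

(** * Complex numbers and continuity *)

Lemma continuous_compose (A B C : topologicalType) (f : A -> B) (g : B -> C) :
  continuous f -> continuous g -> continuous (fun t => g (f t)).
Proof.
by move=> fc gc t; apply: (@continuous_comp _ _ _ f g t); [exact: fc|exact: gc].
Qed.

Lemma continuous_pr1 (A B : topologicalType) : continuous (fun p : A * B => p.1).
Proof. by move=> p; exact: cvg_fst. Qed.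

Lemma continuous_pr2 (A B : topologicalType) : continuous (fun p : A * B => p.2).
Proof. by move=> p; exact: cvg_snd. Qed.

Lemma continuous_idfun (A : topologicalType) : continuous (fun x : A => x).
Proof. by move=> x; exact: cvg_id. Qed.

Lemma continuous_at_compose (A B C : topologicalType) (f : A -> B) (g : B -> C)
    (x : A) : continuous f -> {for f x, continuous g} ->
  {for x, continuous (fun t => g (f t))}.
Proof. by move=> fc gc; apply: (@continuous_comp _ _ _ f g x); [exact: fc|]. Qed.

Section ComplexNumbers.
Variable R : realType.
Implicit Types (z w : R[i]) (T : topologicalType).

Local Notation modc := (@ComplexField.Normc.normc R).

(** [modc] is the modulus as a real number, the norm of [R[i]] being
complex-valued. *)
Lemma modcE z : `|z| = (modc z)%:C. Proof. by case: z. Qed.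

Lemma modc_ge0 z : 0 <= modc z.
Proof. by case: z => a b; rewrite /= sqrtr_ge0. Qed.

Lemma modcM z w : modc (z * w) = modc z * modc w.
Proof. exact: ComplexField.Normc.normcM. Qed.

Lemma modcD z w : modc (z + w) <= modc z + modc w.
Proof. exact: le_normcD. Qed.

Lemma modc0 : modc 0 = 0. Proof. exact: ComplexField.Normc.normc0. Qed.

Lemma modcR (r : R) : modc r%:C = `|r|.
Proof. by rewrite /= expr0n addr0 sqrtr_sqr. Qed.

Lemma modc_expi u : modc (expi u) = 1.
Proof. by rewrite /expi /= cos2Dsin2 sqrtr1. Qed.

Lemma Re_le_modc z : `|complex.Re z| <= modc z.
Proof. by have := normc_ge_Re z; rewrite modcE lecR. Qed.

Lemma Im_le_modc z : `|complex.Im z| <= modc z.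
Proof.
case: z => a b /=; rewrite -sqrtr_sqr ler_wsqrtr // lerDr; exact: sqr_ge0.
Qed.

Lemma modc_le_ReIm z : modc z <= `|complex.Re z| + `|complex.Im z|.
Proof.
case: z => a b /=; rewrite -[leRHS]ger0_norm ?addr_ge0 // -sqrtr_sqr ler_wsqrtr //.
by rewrite sqrrD !real_normK ?num_real // addrAC lerDl mulrn_wge0 // mulr_ge0.
Qed.

Lemma complexP z w : complex.Re z = complex.Re w ->
  complex.Im z = complex.Im w -> z = w.
Proof. by case: z w => a b [c d] /= -> ->. Qed.

Lemma ReD z w : complex.Re (z + w) = complex.Re z + complex.Re w.
Proof. by case: z w => a b []. Qed.

Lemma ImD z w : complex.Im (z + w) = complex.Im z + complex.Im w.
Proof. by case: z w => a b []. Qed.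

Lemma ReM z w : complex.Re (z * w) =
  complex.Re z * complex.Re w - complex.Im z * complex.Im w.
Proof. by case: z w => a b []. Qed.

Lemma ImM z w : complex.Im (z * w) =
  complex.Re z * complex.Im w + complex.Im z * complex.Re w.
Proof. by case: z w => a b []. Qed.

Lemma Re_realM (r : R) w : complex.Re (r%:C * w) = r * complex.Re w.
Proof. by rewrite ReM /= mul0r subr0. Qed.

Lemma Im_realM (r : R) w : complex.Im (r%:C * w) = r * complex.Im w.
Proof. by rewrite ImM /= mul0r addr0. Qed.

Lemma expiD (u v : R) : expi (u + v) = expi u * expi v.
Proof.
by apply: complexP; rewrite ?ReM ?ImM /expi /= ?cosD ?sinD // addrC.
Qed.

Lemma expi0 : expi (0 : R) = 1.
Proof. by rewrite /expi cos0 sin0. Qed.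

Lemma cvg_complex T (F : set_system T) {FF : Filter F} (f : T -> R[i]) z :
  complex.Re (f x) @[x --> F] --> complex.Re z ->
  complex.Im (f x) @[x --> F] --> complex.Im z ->
  (f x : R[i]^o) @[x --> F] --> (z : R[i]^o).
Proof.
move=> /cvgrPdist_lt fr /cvgrPdist_lt fi.
apply/(@cvgrPdist_lt _ (R[i])^o) => e e0.
have eE : e = (complex.Re e)%:C.
  by apply: complexP => //=; exact/ger0_Im/ltW.
have e0' : 0 < complex.Re e by rewrite -ltcR -eE.
have e2 : 0 < complex.Re e / 2 by rewrite divr_gt0.
near=> x.
rewrite eE modcE ltcR.
apply: (le_lt_trans (modc_le_ReIm _)).
rewrite [ltRHS]splitr ltrD //.
- have -> : complex.Re (z - f x) = complex.Re z - complex.Re (f x).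
    by case: (z) (f x) => a b [].
  by near: x; exact: fr.
- have -> : complex.Im (z - f x) = complex.Im z - complex.Im (f x).
    by case: (z) (f x) => a b [].
  by near: x; exact: fi.
Unshelve. all: by end_near. Qed.

Lemma Re_continuous : continuous (@complex.Re R : R[i]^o -> R).
Proof.
move=> z; apply/(cvgrPdist_lt (FF := nbhs_filter (z : R[i]^o))) => e e0.
exists e%:C; first by rewrite /= ltcR.
move=> w /=; rewrite modcE ltcR; apply: le_lt_trans.
have -> : complex.Re z - complex.Re w = complex.Re (z - w).
  by case: (z) w => a b [].
exact: Re_le_modc.
Qed.

Lemma Im_continuous : continuous (@complex.Im R : R[i]^o -> R).
Proof.
move=> z; apply/(cvgrPdist_lt (FF := nbhs_filter (z : R[i]^o))) => e e0.
exists e%:C; first by rewrite /= ltcR.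
move=> w /=; rewrite modcE ltcR; apply: le_lt_trans.
have -> : complex.Im z - complex.Im w = complex.Im (z - w).
  by case: (z) w => a b [].
exact: Im_le_modc.
Qed.

Lemma continuous_ReIm T (f : T -> R[i]) :
  continuous (f : T -> R[i]^o) <->
  continuous (@complex.Re R \o f) /\ continuous (@complex.Im R \o f).
Proof.
split=> [fc|[fr fi] x]; last exact: cvg_complex (fr x) (fi x).
split=> x.
- exact: (continuous_comp (fc x) (Re_continuous (x := f x))).
- exact: (continuous_comp (fc x) (Im_continuous (x := f x))).
Qed.

Lemma continuousMc T (f g : T -> R[i]) :
  continuous (f : T -> R[i]^o) -> continuous (g : T -> R[i]^o) ->
  continuous ((fun x => f x * g x) : T -> R[i]^o).
Proof. by move=> fc gc x; apply: (@cvgM R[i]); [exact: fc|exact: gc]. Qed.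

Lemma continuous_atMc T (f g : T -> R[i]) (x : T) :
  {for x, continuous (f : T -> R[i]^o)} -> {for x, continuous (g : T -> R[i]^o)} ->
  {for x, continuous ((fun x => f x * g x) : T -> R[i]^o)}.
Proof. by move=> fc gc; apply: (@cvgM R[i]); [exact: fc|exact: gc]. Qed.

Lemma continuousDc T (f g : T -> R[i]) :
  continuous (f : T -> R[i]^o) -> continuous (g : T -> R[i]^o) ->
  continuous ((fun x => f x + g x) : T -> R[i]^o).
Proof. by move=> fc gc x; apply: (@cvgD R[i]); [exact: fc|exact: gc]. Qed.

Lemma continuous_expi T (f : T -> R) :
  continuous f -> continuous ((fun x => expi (f x)) : T -> R[i]^o).
Proof.
move=> fc; apply/continuous_ReIm; split => x; apply: continuous_comp.
- exact: fc.
- exact: continuous_cos.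
- exact: fc.
- exact: continuous_sin.
Qed.

Lemma continuous_realc T (f : T -> R) :
  continuous f -> continuous ((fun x => (f x)%:C) : T -> R[i]^o).
Proof.
by move=> fc; apply/continuous_ReIm; split => // x; exact: cvg_cst.
Qed.

End ComplexNumbers.
Notation modc := (@ComplexField.Normc.normc _).

(** * Integrals over the real line *)

Section RealLine.
Variable R : realType.
Local Notation mu := (@lebesgue_measure R).

Lemma oneDsqrV_ge0 (u : R) : 0 <= (oneDsqr u)^-1.
Proof. by rewrite invr_ge0 (le_trans ler01) ?oneDsqr_ge1. Qed.

Lemma integral_oneDsqrV :
  (\int[mu]_u ((oneDsqr u)^-1)%:E = (pi : R)%:E)%E.
Proof.
rewrite ge0_symfun_integralT.
- rewrite (_ : [set x | _] = `[0, +oo[%classic); last first.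
    by apply/seteqP; split => x/=; rewrite in_itv/= andbT.
  by rewrite integral0y_oneDsqr -EFinM mulrCA divff ?mulr1.
- exact: oneDsqrV_ge0.
- exact: continuous_oneDsqrV.
- by move=> x /=; rewrite /oneDsqr sqrrN.
Qed.

Lemma integrable_oneDsqrV (M : R) :
  mu.-integrable setT (EFin \o (fun u => M / oneDsqr u)).
Proof.
have -> : (EFin \o (fun u => M / oneDsqr u)) =
    (fun u => M%:E * ((oneDsqr u)^-1)%:E)%E by apply/funext => u /=; rewrite EFinM.
apply: integrableZl => //; apply/integrableP; split.
  apply/measurable_EFinP; apply: continuous_measurable_fun.
  exact: continuous_oneDsqrV.
under eq_integral => u _.
  rewrite gee0_abs ?lee_fin ?oneDsqrV_ge0 //.
  over.
by rewrite integral_oneDsqrV ltry.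
Qed.

Lemma Rintegral_oneDsqrV (M : R) :
  Rintegral mu setT (fun u => M / oneDsqr u) = M * pi.
Proof.
rewrite RintegralZl //; last first.
  have := integrable_oneDsqrV 1; rewrite (_ : (fun u => 1 / _) = fun u => (oneDsqr u)^-1) //.
  by apply/funext => u; rewrite mul1r.
by rewrite /Rintegral integral_oneDsqrV.
Qed.

Lemma integrable_dominated (f : R -> R) (M : R) : measurable_fun setT f ->
  (forall u, `|f u| <= M / oneDsqr u) -> mu.-integrable setT (EFin \o f).
Proof.
move=> mf fM; apply: le_integrable (integrable_oneDsqrV M) => //.
  exact/measurable_EFinP.
move=> u _ /=; rewrite lee_fin (le_trans (fM u)) // ler_norm //.
Qed.

Lemma Rintegral_dominated_le (f : R -> R) (M : R) : measurable_fun setT f ->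
  (forall u, `|f u| <= M / oneDsqr u) -> `|Rintegral mu setT f| <= M * pi.
Proof.
move=> mf fM; have fi := integrable_dominated mf fM.
apply: (le_trans (le_normr_Rintegral _ fi)) => //.
rewrite -Rintegral_oneDsqrV; apply: le_Rintegral => //.
- apply: (@integrable_dominated _ M).
    by apply: measurableT_comp.
  by move=> u; rewrite normr_id.
- exact: integrable_oneDsqrV.
Qed.

Lemma cvg_Rintegral_dominated (k : nat -> R -> R) (f : R -> R) (M : R) :
  (forall m, measurable_fun setT (k m)) ->
  (forall m u, `|k m u| <= M / oneDsqr u) ->
  (forall u, k m u @[m --> \oo] --> f u) ->
  Rintegral mu setT (k m) @[m --> \oo] --> Rintegral mu setT f.
Proof.
move=> mk kM kf.
have mf : measurable_fun setT f.
  by apply: (@measurable_fun_cvg _ _ R setT k) => // u _; exact: kf.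
have h1 m : measurable_fun setT (EFin \o k m) by exact/measurable_EFinP.
have h2 : measurable_fun setT (EFin \o f) by exact/measurable_EFinP.
have h3 : {ae mu, forall u, setT u ->
    (EFin \o k m) u @[m --> \oo] --> (EFin \o f) u}.
  by apply: aeW => u _; apply: cvg_EFin; [exact: nearW|exact: kf].
have h4 : {ae mu, forall u m, setT u ->
    (`|(EFin \o k m) u| <= (EFin \o (fun v => (M / oneDsqr v)%R)) u)%E}.
  by apply: aeW => u m _ /=; rewrite lee_fin.
have [fi _ h] := @dominated_convergence _ _ R mu _ measurableT _ _ _ h1 h2 h3
  (integrable_oneDsqrV M) h4.
by apply: fine_cvg; rewrite fineK //; exact: integrable_fin_num.
Qed.

Lemma integral_affine_ge0 (c d : R) (f : R -> R) : 0 < c -> continuous f ->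
  (forall u, 0 <= f u) ->
  (\int[mu]_u (f u)%:E = c%:E * \int[mu]_u (f (c * u + d))%:E)%E.
Proof.
move=> c0 fc f0.
pose F u := c * u + d.
have dF (u : R) : is_derive u (1 : R) F c.
  by apply: is_derive_eq; rewrite addr0 /GRing.scale /= ?mulr1 ?mulr0 ?add0r ?addr0.
have F' : derive1 F = cst c by apply/funext => u; rewrite derive1E; apply: derive_val.
have cF : continuous F.
  by move=> u; apply: cvgD; [apply: cvgM; [exact: cvg_cst|exact: cvg_id]|exact: cvg_cst].
rewrite (@increasing_ge0_integration_by_substitutionT _ F f) //.
- rewrite -ge0_integralZl //=.
  + by apply: eq_integral => u _; rewrite F' /= EFinM muleC.
  + apply/measurable_EFinP; apply: continuous_measurable_fun => u.
    by apply: continuous_comp; [exact: cF|exact: fc].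
  + by move=> u _; rewrite lee_fin.
  + by rewrite lee_fin ltW.
- by move=> u v uv; rewrite /F ltrD2r ltr_pM2l.
- by rewrite F' => u; exact: cvg_cst.
- by rewrite F'; exact: is_cvg_cst.
- by rewrite F'; exact: is_cvg_cst.
- apply/cvgrNyPle => A; near=> u; rewrite /F -lerBrDr -ler_pdivlMl //.
- apply/cvgryPge => A; near=> u; rewrite /F -lerBlDr -ler_pdivrMl //.
Unshelve. all: by end_near. Qed.

Lemma integral_opp_ge0 (f : R -> R) : continuous f -> (forall u, 0 <= f u) ->
  (\int[mu]_u (f u)%:E = \int[mu]_u (f (- u))%:E)%E.
Proof.
move=> fc f0.
transitivity (\int[pushforward mu (-%R : R -> measurableTypeR R)]_u (f u)%:E)%E.
  by apply: eq_measure_integral => A mA _; rewrite [RHS]lebesgue_measureN.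
rewrite ge0_integral_pushforward //=.
- by apply/measurable_EFinP; exact: continuous_measurable_fun.
- by move=> u _; rewrite lee_fin.
Qed.

(** Through this decomposition a change of variables for nonnegative functions
extends to signed ones. *)
Lemma Rintegral_pos_neg (f : R -> R) :
  Rintegral mu setT f = fine (\int[mu]_u (Num.max (f u) 0)%:E
                              - \int[mu]_u (Num.max (- f u) 0)%:E)%E.
Proof.
rewrite /Rintegral integralE; congr (fine (_ - _)%E); apply: eq_integral => u _.
  by rewrite funeposE /= EFin_max.
by rewrite funenegE /= EFin_max.
Qed.

Lemma continuous_pos_part (f : R -> R) : continuous f ->
  continuous (fun u => Num.max (f u) 0).
Proof. by move=> fc u; apply: continuous_max; [exact: fc|exact: cvg_cst]. Qed.

Lemma fine_mulB (c : R) (x y : \bar R) : 0 < c ->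
  fine (c%:E * x - c%:E * y)%E = c * fine (x - y)%E.
Proof.
move=> c0; case: x y => [x||] [y||] //=;
  rewrite ?gt0_muley ?gt0_muleNy ?lte_fin //= ?mulr0 //.
by rewrite mulrBr.
Qed.

Lemma Rintegral_affine (c d : R) (f : R -> R) : 0 < c -> continuous f ->
  Rintegral mu setT (fun u => f (c * u + d)) = c^-1 * Rintegral mu setT f.
Proof.
move=> c0 fc; apply: (mulfI (lt0r_neq0 c0)); rewrite mulrA divff ?gt_eqF // mul1r.
rewrite !Rintegral_pos_neg.
rewrite [in RHS](integral_affine_ge0 d c0 (continuous_pos_part fc)); last first.
  by move=> u; rewrite le_max lexx orbT.
rewrite [in RHS](integral_affine_ge0 d c0 (f := fun u => Num.max (- f u) 0)).
- by rewrite fine_mulB.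
- by apply: continuous_pos_part => u; apply: cvgN; exact: fc.
- by move=> u; rewrite le_max lexx orbT.
Qed.

Lemma Rintegral_opp (f : R -> R) : continuous f ->
  Rintegral mu setT (fun u => f (- u)) = Rintegral mu setT f.
Proof.
move=> fc; rewrite !Rintegral_pos_neg; congr (fine (_ - _)%E); apply/esym.
  apply: (integral_opp_ge0 (continuous_pos_part fc)).
  by move=> u; rewrite le_max lexx orbT.
apply: (integral_opp_ge0 (f := fun u => Num.max (- f u) 0)).
  by apply: continuous_pos_part => u; apply: cvgN; exact: fc.
by move=> u; rewrite le_max lexx orbT.
Qed.

End RealLine.

(** * Fubini's theorem and parametric integrals *)

Section PlaneAndParameters.
Variable R : realType.
Local Notation mu := (@lebesgue_measure R).

(** An open set is a countable union of squares with rational centre and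
radius. *)
Lemma open_measurable_plane (A : set (R * R)) : open A -> measurable A.
Proof.
move=> oA.
pose box (p q r : rat) : set (R * R) :=
  ball (ratr p : R) (ratr r : R) `*` ball (ratr q : R) (ratr r : R).
pose F p q r := if asbool (box p q r `<=` A) then box p q r else set0.
have -> : A = \bigcup_p \bigcup_q \bigcup_r F p q r.
  apply/seteqP; split=> [[x y] Axy|z [p _ [q _ [r _]]]]; last first.
    by rewrite /F; case: asboolP => // sA; exact: sA.
  have /nbhs_ballP[e /= e0 eA] : nbhs (x, y) A by exact: open_nbhs_nbhs.
  have e2 : (0 : R) < e / 2 by rewrite divr_gt0.
  have [r] := rat_in_itvoo e2; rewrite in_itv /= => /andP[r0 re].
  (* a square of radius [r < e / 2] around a rational point within [r] of
  [(x, y)] lies in the ball of radius [e] *)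
  have near_rat (z : R) : exists p : rat, ball (ratr p : R) (ratr r : R) z.
    have [|p] := @rat_in_itvoo R (z - ratr r) (z + ratr r).
      by rewrite ltrBlDr -addrA ltrDl addr_gt0.
    rewrite in_itv /= => pr; exists p; apply: ball_sym.
    by rewrite ball_itv /= in_itv.
  have [p px] := near_rat x; have [q qy] := near_rat y.
  exists p => //; exists q => //; exists r => //; rewrite /F.
  case: asboolP => [_|]; first by split.
  case=> -[x' y'] /= [px' qy']; apply: eA.
  have le_e : (ratr r : R) + ratr r <= e by rewrite [leRHS]splitr lerD // ltW.
  split; apply: (le_ball le_e) => /=.
    exact: ball_triangle (ball_sym px) px'.
  exact: ball_triangle (ball_sym qy) qy'.
apply: bigcupT_measurable_rat => p; apply: bigcupT_measurable_rat => q.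
apply: bigcupT_measurable_rat => r; rewrite /F; case: asboolP => // _.
by apply: measurableX; exact: measurable_ball.
Qed.

Lemma continuous_measurable_plane (h : R * R -> R) :
  continuous h -> measurable_fun setT h.
Proof.
move=> hc; apply: (measurability _ (RGenOInfty.measurableE R)) => //.
move=> _ [_ [a ->] <-]; rewrite setTI; apply: open_measurable_plane.
by apply: open_comp; [move=> x _; exact: hc|exact: interval_open].
Qed.

Lemma EFin_Rintegral (f : R -> R) : mu.-integrable setT (EFin \o f) ->
  (Rintegral mu setT f)%:E = (\int[mu]_u (f u)%:E)%E.
Proof. by move=> fi; rewrite /Rintegral fineK //; exact: integrable_fin_num. Qed.

Lemma Rintegral_swap (h : R * R -> R) (M : R) : continuous h ->
  (forall u v, `|h (u, v)| <= M / oneDsqr u / oneDsqr v) ->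
  Rintegral mu setT (fun u => Rintegral mu setT (fun v => h (u, v))) =
  Rintegral mu setT (fun v => Rintegral mu setT (fun u => h (u, v))).
Proof.
move=> hc hM.
have mh : measurable_fun setT h by exact: continuous_measurable_plane.
have mh1 v : measurable_fun setT (fun u => h (u, v)).
  by apply: (measurableT_comp mh); apply: measurable_fun_pair => //; exact: measurable_id.
have mh2 u : measurable_fun setT (fun v => h (u, v)).
  by apply: (measurableT_comp mh); apply: measurable_fun_pair => //; exact: measurable_id.
have i2 u : mu.-integrable setT (EFin \o (fun v => h (u, v))).
  by apply: (integrable_dominated (mh2 u) (M := M / oneDsqr u)) => v; exact: hM.
have i1 v : mu.-integrable setT (EFin \o (fun u => h (u, v))).
  apply: (integrable_dominated (mh1 v) (M := M / oneDsqr v)) => u.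
  by rewrite mulrAC; exact: hM.
have ih : (mu \x mu)%E.-integrable setT (EFin \o h).
  apply/(@integrable12ltyP _ _ _ _ R mu mu); first exact/measurable_EFinP.
  apply: (@le_lt_trans _ _ (\int[mu]_u ((M * pi) / oneDsqr u)%:E)%E).
    apply: ge0_le_integral => //.
    - by move=> u _; apply: integral_ge0.
    - have ma : measurable_fun setT (fun z => `|(h z)%:E|%E).
        by apply: measurableT_comp => //; exact/measurable_EFinP.
      exact: (@measurable_fun_fubini_tonelli_F _ _ _ _ R mu _ ma (fun=> abse_ge0 _)).
    - by have /integrableP[] := @integrable_oneDsqrV R (M * pi).
    - move=> u _ /=.
      have -> : (\int[mu]_v `|(h (u, v))%:E| =
          \int[mu]_v (`|h (u, v)|)%:E)%E by [].
      have ia : mu.-integrable setT (EFin \o (fun v => `|h (u, v)|)).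
        apply: (@integrable_dominated _ _ (M / oneDsqr u)).
          exact: measurableT_comp.
        by move=> v; rewrite normr_id.
      rewrite -EFin_Rintegral // lee_fin.
      apply: le_trans (ler_norm _) _; rewrite mulrAC.
      apply: Rintegral_dominated_le; first exact: measurableT_comp.
      by move=> v; rewrite normr_id.
  rewrite -EFin_Rintegral ?ltry //; exact: integrable_oneDsqrV.
have := Fubini ih => /=.
under eq_integral do rewrite -EFin_Rintegral //.
under [in RHS]eq_integral do rewrite -EFin_Rintegral //.
by move/(congr1 fine).
Qed.

Lemma continuous_pairing (A B C T : topologicalType) (k : A * B -> C)
    (f : T -> A) (g : T -> B) : continuous k -> continuous f -> continuous g ->
  continuous (fun t => k (f t, g t)).
Proof.
move=> kc fc gc t.
apply: (@continuous_comp _ _ _ (fun t => (f t, g t)) k t); last exact: kc.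
by apply: cvg_pair; [exact: fc|exact: gc].
Qed.

(** Dominated convergence speaks of sequences; this turns it into continuity of
parametric integrals. If continuity fails at [t0], bad points can be chosen in
the balls of radius [1 / (m + 1)]. *)
Lemma continuous_sequential (T : pseudoMetricType R) (F : T -> R) (t0 : T) :
  (forall s : nat -> T, s m @[m --> \oo] --> t0 ->
    F (s m) @[m --> \oo] --> F t0) ->
  F x @[x --> t0] --> F t0.
Proof.
move=> h; apply/cvgrPdist_lt => e e0; apply: contrapT => hn.
have bad (m : nat) : exists x, ball t0 m.+1%:R^-1 x /\ e <= `|F t0 - F x|.
  apply: contrapT => /forallNP nx; apply: hn.
  apply/nbhs_ballP; exists m.+1%:R^-1; first by rewrite /= invr_gt0.
  move=> x bx /=; rewrite ltNge; apply/negP => ex.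
  by apply: (nx x); split.
have [s /all_and2[sb se]] := choice bad.
have st : s m @[m --> \oo] --> t0.
  apply/cvg_ballP => d d0; near=> m; apply: le_ball (sb m).
  by apply: ltW; near: m; exact: (near_infty_natSinv_lt (PosNum d0)).
have /cvgrPdist_lt /(_ e e0) [N _ /(_ N (leqnn N))] := h s st.
by rewrite ltNge se.
Unshelve. all: by end_near. Qed.

Lemma continuous_Rintegral_param (T : pseudoMetricType R) (k : T * R -> R)
    (M : R) : continuous k ->
  (forall t u, `|k (t, u)| <= M / oneDsqr u) ->
  continuous (fun t => Rintegral mu setT (fun u => k (t, u))).
Proof.
move=> kc kM t0; apply: continuous_sequential => s st.
apply: (@cvg_Rintegral_dominated _ (fun m u => k (s m, u)) _ M) => //.
- move=> m; apply: continuous_measurable_fun.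
  by apply: continuous_pairing => // u; [exact: cvg_cst|exact: cvg_id].
- move=> u; apply: (@cvg_comp _ _ _ (fun m => (s m, u)) k); last exact: kc.
  exact: (cvg_pair st (cvg_cst u)).
Qed.

End PlaneAndParameters.

(** * Complex integrals and row vectors *)

Section ComplexIntegral.
Variable R : realType.
Implicit Types (f : R -> R[i]) (M : R).

(** The function [1 / (1 + u^2)] has integral [pi], and the bound is insensitive
to phases [e^(i a(u))]; it is the form of integrability used throughout. *)
Definition dominated1 M f := forall u : R, modc (f u) <= M / oneDsqr u.

Lemma dominated1_Re M f u : dominated1 M f ->
  `|complex.Re (f u)| <= M / oneDsqr u.
Proof. by move=> fM; exact: le_trans (Re_le_modc _) (fM u). Qed.

Lemma dominated1_Im M f u : dominated1 M f ->
  `|complex.Im (f u)| <= M / oneDsqr u.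
Proof. by move=> fM; exact: le_trans (Im_le_modc _) (fM u). Qed.

Lemma continuous_Re (T : topologicalType) (f : T -> R[i]) :
  continuous (f : T -> R[i]^o) ->
  continuous (@complex.Re R \o f).
Proof. by move=> fc; have [] := (continuous_ReIm f).1 fc. Qed.

Lemma continuous_Im (T : topologicalType) (f : T -> R[i]) :
  continuous (f : T -> R[i]^o) -> continuous (@complex.Im R \o f).
Proof. by move=> fc; have [] := (continuous_ReIm f).1 fc. Qed.

Lemma integrable_Re M f : continuous (f : R -> R[i]^o) -> dominated1 M f ->
  (@lebesgue_measure R).-integrable setT (EFin \o (@complex.Re R \o f)).
Proof.
move=> fc fM; apply: (@integrable_dominated _ _ M).
  by apply: continuous_measurable_fun; apply: continuous_Re.
by move=> u; exact: dominated1_Re.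
Qed.

Lemma integrable_Im M f : continuous (f : R -> R[i]^o) -> dominated1 M f ->
  (@lebesgue_measure R).-integrable setT (EFin \o (@complex.Im R \o f)).
Proof.
move=> fc fM; apply: (@integrable_dominated _ _ M).
  by apply: continuous_measurable_fun; apply: continuous_Im.
by move=> u; exact: dominated1_Im.
Qed.

Lemma modc_cintegral_le M f : continuous (f : R -> R[i]^o) ->
  dominated1 M f -> modc (cintegral f) <= 2 * pi * M.
Proof.
move=> fc fM; apply: le_trans (modc_le_ReIm _) _.
have -> : 2 * pi * M = M * pi + M * pi by ring.
apply: lerD; apply: Rintegral_dominated_le.
- by apply: continuous_measurable_fun; apply: continuous_Re.
- by move=> u; exact: dominated1_Re.
- by apply: continuous_measurable_fun; apply: continuous_Im.
- by move=> u; exact: dominated1_Im.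
Qed.

Lemma cintegralD M1 M2 f1 f2 :
  continuous (f1 : R -> R[i]^o) -> dominated1 M1 f1 ->
  continuous (f2 : R -> R[i]^o) -> dominated1 M2 f2 ->
  cintegral (fun u => f1 u + f2 u) = cintegral f1 + cintegral f2.
Proof.
move=> c1 d1 c2 d2; apply: complexP; rewrite /cintegral /=.
- rewrite -(RintegralD measurableT (integrable_Re c1 d1) (integrable_Re c2 d2)).
  by apply: eq_Rintegral => u _ /=; rewrite ReD.
- rewrite -(RintegralD measurableT (integrable_Im c1 d1) (integrable_Im c2 d2)).
  by apply: eq_Rintegral => u _ /=; rewrite ImD.
Qed.

Lemma cintegralZ M f c : continuous (f : R -> R[i]^o) -> dominated1 M f ->
  cintegral (fun u => c * f u) = c * cintegral f.
Proof.
move=> fc fM.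
have rZ (r : R) := RintegralZl r measurableT (integrable_Re fc fM).
have iZ (r : R) := RintegralZl r measurableT (integrable_Im fc fM).
have ri (r : R) : (@lebesgue_measure R).-integrable setT
    (EFin \o (fun u => r * (@complex.Re R \o f) u)).
  rewrite (_ : _ \o _ = (fun u => r%:E * ((@complex.Re R \o f) u)%:E)%E).
    by apply: integrableZl => //; exact: integrable_Re fc fM.
  by apply/funext => u; rewrite -EFinM.
have ii (r : R) : (@lebesgue_measure R).-integrable setT
    (EFin \o (fun u => r * (@complex.Im R \o f) u)).
  rewrite (_ : _ \o _ = (fun u => r%:E * ((@complex.Im R \o f) u)%:E)%E).
    by apply: integrableZl => //; exact: integrable_Im fc fM.
  by apply/funext => u; rewrite -EFinM.
apply: complexP; rewrite ?ReM ?ImM /cintegral /=.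
- rewrite -rZ -iZ -RintegralB //.
  by apply: eq_Rintegral => u _ /=; rewrite ReM.
- rewrite -rZ -iZ -RintegralD //.
  by apply: eq_Rintegral => u _ /=; rewrite ImM.
Qed.

Lemma cintegral_affine c d f : 0 < c -> continuous (f : R -> R[i]^o) ->
  cintegral (fun u => f (c * u + d)) = (c^-1)%:C * cintegral f.
Proof.
move=> c0 fc; apply: complexP; rewrite ?Re_realM ?Im_realM /cintegral /=.
- by rewrite -(Rintegral_affine d c0 (continuous_Re fc)).
- by rewrite -(Rintegral_affine d c0 (continuous_Im fc)).
Qed.

Lemma cintegral_opp f : continuous (f : R -> R[i]^o) ->
  cintegral (fun u => f (- u)) = cintegral f.
Proof.
move=> fc; apply: complexP; rewrite /cintegral /=.
- by rewrite -(Rintegral_opp (continuous_Re fc)).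
- by rewrite -(Rintegral_opp (continuous_Im fc)).
Qed.

Lemma cvg_cintegral M (k : nat -> R -> R[i]) f :
  (forall m, continuous (k m : R -> R[i]^o)) -> (forall m, dominated1 M (k m)) ->
  (forall u, complex.Re (k m u) @[m --> \oo] --> complex.Re (f u)) ->
  (forall u, complex.Im (k m u) @[m --> \oo] --> complex.Im (f u)) ->
  (cintegral (k m) : R[i]^o) @[m --> \oo] --> (cintegral f : R[i]^o).
Proof.
move=> kc kM kr ki; apply: cvg_complex.
- apply: (@cvg_Rintegral_dominated _ (fun m => @complex.Re R \o k m) _ M) => //.
  + by move=> m; apply: continuous_measurable_fun; apply: continuous_Re.
  + by move=> m u; exact: dominated1_Re.
- apply: (@cvg_Rintegral_dominated _ (fun m => @complex.Im R \o k m) _ M) => //.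
  + by move=> m; apply: continuous_measurable_fun; apply: continuous_Im.
  + by move=> m u; exact: dominated1_Im.
Qed.

Lemma continuous_cintegral_param (T : pseudoMetricType R) (k : T * R -> R[i]) M :
  continuous (k : T * R -> R[i]^o) ->
  (forall t, dominated1 M (fun u => k (t, u))) ->
  continuous ((fun t => cintegral (fun u => k (t, u))) : T -> R[i]^o).
Proof.
move=> kc kM; apply/continuous_ReIm; split.
- apply: (@continuous_Rintegral_param _ T (@complex.Re R \o k) M).
    exact: continuous_Re.
  by move=> t u; apply: (dominated1_Re _ (kM t)).
- apply: (@continuous_Rintegral_param _ T (@complex.Im R \o k) M).
    exact: continuous_Im.
  by move=> t u; apply: (dominated1_Im _ (kM t)).
Qed.

Lemma cintegral_swap (h : R * R -> R[i]) M : continuous (h : R * R -> R[i]^o) ->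
  (forall u v, modc (h (u, v)) <= M / oneDsqr u / oneDsqr v) ->
  cintegral (fun u => cintegral (fun v => h (u, v))) =
  cintegral (fun v => cintegral (fun u => h (u, v))).
Proof.
move=> hc hM; apply: complexP; rewrite /cintegral /=.
- apply: (@Rintegral_swap _ (@complex.Re R \o h) M); first exact: continuous_Re.
  by move=> u v; apply: le_trans (Re_le_modc _) (hM u v).
- apply: (@Rintegral_swap _ (@complex.Im R \o h) M); first exact: continuous_Im.
  by move=> u v; apply: le_trans (Im_le_modc _) (hM u v).
Qed.

End ComplexIntegral.

Section RowVectors.
Variable R : realType.

Definition cons_rv n (u : R) (v : 'rV[R]_n) : 'rV[R]_n.+1 :=
  row_mx (u%:M : 'rV[R]_1) v.

Lemma cons_rv0 n u (v : 'rV[R]_n) : cons_rv u v 0 ord0 = u.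
Proof.
transitivity (row_mx (u%:M : 'rV[R]_1) v 0 (lshift n ord0)).
  by congr (_ _ _); exact: val_inj.
by rewrite row_mxEl mxE mulr1n.
Qed.

Lemma cons_rvS n u (v : 'rV[R]_n) k : cons_rv u v 0 (lift ord0 k) = v 0 k.
Proof.
rewrite -(row_mxEr (u%:M : 'rV[R]_1) v 0 k); congr (_ _ _); exact: val_inj.
Qed.

Lemma cons_rvP n (x y : 'rV[R]_n.+1) : x 0 ord0 = y 0 ord0 ->
  (forall k, x 0 (lift ord0 k) = y 0 (lift ord0 k)) -> x = y.
Proof.
move=> e0 eS; apply/rowP => i; case: (unliftP ord0 i) => [k|] -> //.
Qed.

Lemma cons_rv_eta n (x : 'rV[R]_n.+1) :
  x = cons_rv (x 0 ord0) (\row_k x 0 (lift ord0 k)).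
Proof. by apply: cons_rvP => [|k]; rewrite ?cons_rv0 ?cons_rvS ?mxE. Qed.

Lemma cons_rvZ n c u (v : 'rV[R]_n) :
  c *: cons_rv u v = cons_rv (c * u) (c *: v).
Proof. by apply: cons_rvP => [|k]; rewrite mxE ?cons_rv0 ?cons_rvS ?mxE. Qed.

Lemma cons_rvN n u (v : 'rV[R]_n) : - cons_rv u v = cons_rv (- u) (- v).
Proof. by apply: cons_rvP => [|k]; rewrite mxE ?cons_rv0 ?cons_rvS ?mxE. Qed.

Lemma dotp_cons n u u' (v v' : 'rV[R]_n) :
  dotp (cons_rv u v) (cons_rv u' v') = u * u' + dotp v v'.
Proof.
rewrite /dotp big_ord_recl !cons_rv0; congr (_ + _).
by apply: eq_bigr => k _; rewrite !cons_rvS.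
Qed.

Lemma continuous_rV (T : topologicalType) n (f : T -> 'rV[R]_n) :
  (forall k, continuous (fun t => f t 0 k)) -> continuous f.
Proof.
move=> fc t; apply/cvg_ballP => e e0.
have : \forall s \near t, forall k : 'I_n, ball (f t 0 k) e (f s 0 k).
  apply: filter_forall => k; have /cvg_ballP := fc k t; exact.
apply: filterS => s sb; split => // i j; rewrite !ord1; exact: sb.
Qed.

Lemma continuous_coord n k : continuous (fun v : 'rV[R]_n => v 0 k).
Proof. by move=> v; exact: coord_continuous. Qed.

Lemma continuous_cons_rv (T : topologicalType) n (f : T -> R)
    (g : T -> 'rV[R]_n) : continuous f -> continuous g ->
  continuous (fun t => cons_rv (f t) (g t)).
Proof.
move=> fc gc; apply: continuous_rV => k; case: (unliftP ord0 k) => [j|] ->.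
  rewrite (_ : (fun t => _) = fun t => g t 0 j); last first.
    by apply/funext => t; rewrite cons_rvS.
  exact: (continuous_compose gc (@continuous_coord n j)).
rewrite (_ : (fun t => _) = f) //.
by apply/funext => t; rewrite cons_rv0.
Qed.

Lemma continuous_dotp (T : topologicalType) n (f g : T -> 'rV[R]_n) :
  continuous f -> continuous g -> continuous (fun t => dotp (f t) (g t)).
Proof.
move=> fc gc; rewrite /dotp; apply: continuous_big.
  by move=> z; exact: add_continuous.
move=> k _ t; apply: cvgM.
- exact: (continuous_compose fc (@continuous_coord n k)).
- exact: (continuous_compose gc (@continuous_coord n k)).
Qed.

(** A product weight, because fixing one coordinate leaves the weight of the
others; inductions on the dimension go through slices. *)
Definition weight n (x : 'rV[R]_n) : R := \prod_k (oneDsqr (x 0 k))^-1.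

Lemma weight_ge0 n (x : 'rV[R]_n) : 0 <= weight x.
Proof. by apply: prodr_ge0 => k _; exact: oneDsqrV_ge0. Qed.

Lemma weight_cons n u (v : 'rV[R]_n) :
  weight (cons_rv u v) = (oneDsqr u)^-1 * weight v.
Proof.
rewrite /weight big_ord_recl cons_rv0; congr (_ * _).
by apply: eq_bigr => k _; rewrite cons_rvS.
Qed.

End RowVectors.

(** * Iterated integrals *)

Section IteratedIntegral.
Variable R : realType.

Definition dominated n (M : R) (h : 'rV[R]_n -> R[i]) :=
  forall x, modc (h x) <= M * weight x.

Lemma dominated_ge0 n M (h : 'rV[R]_n -> R[i]) : dominated M h -> 0 <= M.
Proof.
move=> hM; have := le_trans (modc_ge0 _) (hM 0).
suff -> : weight (0 : 'rV[R]_n) = 1 by rewrite mulr1.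
by apply: big1 => k _; rewrite mxE /oneDsqr expr0n addr0 invr1.
Qed.

Lemma dominated_slice n M (h : 'rV[R]_n.+1 -> R[i]) u : dominated M h ->
  dominated (M / oneDsqr u) (fun v => h (cons_rv u v)).
Proof. by move=> hM v; rewrite -mulrA -weight_cons; exact: hM. Qed.

Lemma invr_oneDsqr_le1 (u : R) : (oneDsqr u)^-1 <= 1.
Proof. exact: oneDsqrV_le1. Qed.

Lemma dominated_slice_le n M (h : 'rV[R]_n.+1 -> R[i]) u : dominated M h ->
  dominated M (fun v => h (cons_rv u v)).
Proof.
move=> hM v; apply: le_trans (dominated_slice u hM v) _.
rewrite ler_wpM2r ?weight_ge0 // ler_piMr ?invr_oneDsqr_le1 //.
exact: dominated_ge0 hM.
Qed.

Lemma continuous_slice (T : topologicalType) n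
    (k : T * 'rV[R]_n.+1 -> R[i]) : continuous (k : _ -> R[i]^o) ->
  continuous ((fun p : (T * R) * 'rV[R]_n => k (p.1.1, cons_rv p.1.2 p.2))
    : _ -> R[i]^o).
Proof.
move=> kc; apply: (continuous_pairing kc).
- exact: (continuous_compose (@continuous_pr1 _ _) (@continuous_pr1 _ _)).
- apply: continuous_cons_rv; last exact: continuous_pr2.
  exact: (continuous_compose (@continuous_pr1 _ _) (@continuous_pr2 _ _)).
Qed.

Lemma continuous_cons_slice n (h : 'rV[R]_n.+1 -> R[i]) u :
  continuous (h : _ -> R[i]^o) ->
  continuous ((fun v => h (cons_rv u v)) : _ -> R[i]^o).
Proof.
move=> hc; apply: continuous_compose hc.
by apply: continuous_cons_rv; [exact: cst_continuous|exact: continuous_idfun].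
Qed.

(** Both claims in dimension [n + 1] need both in dimension [n]: the bound
integrates the inner bound, for which the inner integral has to be continuous,
and continuity is dominated convergence under the inner bound. The parameter
space is arbitrary because the step uses the hypothesis with [T * R]. *)
Lemma integral_rV_param_and_bound n :
  (forall M (h : 'rV[R]_n -> R[i]), continuous (h : _ -> R[i]^o) ->
    dominated M h -> modc (integral_rV h) <= (2 * pi) ^+ n * M) /\
  (forall (T : pseudoMetricType R) M (k : T * 'rV[R]_n -> R[i]),
    continuous (k : _ -> R[i]^o) ->
    (forall t, dominated M (fun x => k (t, x))) ->
    continuous ((fun t => integral_rV (fun x => k (t, x))) : T -> R[i]^o)).
Proof.
elim: n => [|n [IHb IHc]].
  split=> [M h _ /(_ 0)|T M k kc _] /=.
    by rewrite /weight big_ord0 mulr1 expr0 mul1r.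
  by apply: (continuous_pairing kc) ; [exact: continuous_idfun|exact: cst_continuous].
have bound_slice M (h : 'rV[R]_n.+1 -> R[i]) :
    continuous (h : _ -> R[i]^o) -> dominated M h ->
    dominated1 ((2 * pi) ^+ n * M)
      (fun u => integral_rV (fun v => h (cons_rv u v))).
  move=> hc hM u; rewrite -mulrA; apply: IHb; last exact: dominated_slice.
  exact: continuous_cons_slice.
split=> [M h hc hM|T M k kc kM].
  rewrite exprS -mulrA; apply: modc_cintegral_le; last exact: bound_slice.
  apply: (IHc R M (fun p => h (cons_rv p.1 p.2))) => [|u].
    apply: continuous_compose hc.
    by apply: continuous_cons_rv; [exact: continuous_pr1|exact: continuous_pr2].
  exact: dominated_slice_le.
apply: (continuous_cintegral_param (M := (2 * pi) ^+ n * M)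
  (k := fun p => integral_rV (fun v => k (p.1, cons_rv p.2 v)))).
  apply: (IHc (T * R)%type M (fun p => k (p.1.1, cons_rv p.1.2 p.2))).
    exact: continuous_slice.
  by move=> [t u] /=; exact: (dominated_slice_le u (kM t)).
move=> t; apply: (bound_slice _ (fun x => k (t, x))); last exact: kM.
by apply: (continuous_pairing kc) ; [exact: cst_continuous|exact: continuous_idfun].
Qed.

Lemma modc_integral_rV_le n M (h : 'rV[R]_n -> R[i]) :
  continuous (h : _ -> R[i]^o) -> dominated M h ->
  modc (integral_rV h) <= (2 * pi) ^+ n * M.
Proof. by have [+ _] := integral_rV_param_and_bound n; exact. Qed.

Lemma continuous_integral_rV_param (T : pseudoMetricType R) n M
    (k : T * 'rV[R]_n -> R[i]) : continuous (k : _ -> R[i]^o) ->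
  (forall t, dominated M (fun x => k (t, x))) ->
  continuous ((fun t => integral_rV (fun x => k (t, x))) : T -> R[i]^o).
Proof. by have [_] := integral_rV_param_and_bound n; exact. Qed.

Lemma continuous_inner_integral n M (h : 'rV[R]_n.+1 -> R[i]) :
  continuous (h : _ -> R[i]^o) -> dominated M h ->
  continuous ((fun u => integral_rV (fun v => h (cons_rv u v))) : R -> R[i]^o).
Proof.
move=> hc hM.
apply: (continuous_integral_rV_param (M := M)
  (k := fun p : R * 'rV[R]_n => h (cons_rv p.1 p.2))) => [|u].
  apply: continuous_compose hc.
  by apply: continuous_cons_rv; [exact: continuous_pr1|exact: continuous_pr2].
exact: dominated_slice_le.
Qed.

Lemma dominated_inner_integral n M (h : 'rV[R]_n.+1 -> R[i]) :
  continuous (h : _ -> R[i]^o) -> dominated M h ->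
  dominated1 ((2 * pi) ^+ n * M)
    (fun u => integral_rV (fun v => h (cons_rv u v))).
Proof.
move=> hc hM u; rewrite -mulrA; apply: modc_integral_rV_le.
  exact: continuous_cons_slice.
exact: dominated_slice.
Qed.

Lemma integral_rVZ n M (h : 'rV[R]_n -> R[i]) c :
  continuous (h : _ -> R[i]^o) -> dominated M h ->
  integral_rV (fun x => c * h x) = c * integral_rV h.
Proof.
elim: n M h => [//|n IH] M h hc hM.
rewrite /= -(cintegralZ c (continuous_inner_integral hc hM)
  (dominated_inner_integral hc hM)).
congr cintegral; apply/funext => u.
apply: (IH M (fun v => h (cons_rv u v))); first exact: continuous_cons_slice.
exact: dominated_slice_le.
Qed.

Lemma integral_rV_scale n M (h : 'rV[R]_n -> R[i]) c : 0 < c ->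
  continuous (h : _ -> R[i]^o) -> dominated M h ->
  integral_rV (fun x => h (c *: x)) = (c ^- n)%:C * integral_rV h.
Proof.
move=> c0; elim: n M h => [|n IH] M h hc hM.
  by rewrite /= scaler0 expr0 invr1 mul1r.
have -> : integral_rV (fun x => h (c *: x)) =
    cintegral (fun u => (c ^- n)%:C *
      (fun u => integral_rV (fun v => h (cons_rv u v))) (c * u + 0)).
  congr cintegral; apply/funext => u.
  rewrite -(IH M (fun v => h (cons_rv (c * u + 0) v))).
  - by congr integral_rV; apply/funext => v; rewrite addr0 -cons_rvZ.
  - exact: continuous_cons_slice.
  - exact: dominated_slice_le.
have ci := continuous_inner_integral hc hM.
rewrite (@cintegral_affine _ c 0 (fun u =>
  (c ^- n)%:C * integral_rV (fun v => h (cons_rv u v))) c0); last first.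
  exact: (continuousMc (@cst_continuous _ _ _) ci).
rewrite (cintegralZ _ ci (dominated_inner_integral hc hM)) mulrA.
by rewrite -rmorphM -invfM -exprS.
Qed.

Lemma integral_rV_opp n M (h : 'rV[R]_n -> R[i]) :
  continuous (h : _ -> R[i]^o) -> dominated M h ->
  integral_rV (fun x => h (- x)) = integral_rV h.
Proof.
elim: n M h => [|n IH] M h hc hM; first by rewrite /= oppr0.
rewrite [RHS]/= -[RHS](cintegral_opp (continuous_inner_integral hc hM)).
congr cintegral; apply/funext => u.
rewrite -(IH M (fun v => h (cons_rv (- u) v))).
- by congr integral_rV; apply/funext => v; rewrite -cons_rvN.
- exact: continuous_cons_slice.
- exact: dominated_slice_le.
Qed.

(** Fubini's theorem in the plane, applied to one coordinate at a time. *)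
Lemma cintegral_integral_rV_swap n M (h : R * 'rV[R]_n -> R[i]) :
  continuous (h : _ -> R[i]^o) ->
  (forall u v, modc (h (u, v)) <= M / oneDsqr u * weight v) ->
  cintegral (fun u => integral_rV (fun v => h (u, v))) =
  integral_rV (fun v => cintegral (fun u => h (u, v))).
Proof.
elim: n M h => [//|n IH] M h hc hM.
have cs w : continuous ((fun p : R * 'rV[R]_n => h (p.1, cons_rv w p.2))
    : _ -> R[i]^o).
  apply: (continuous_pairing hc); first exact: continuous_pr1.
  by apply: continuous_cons_rv ; [exact: cst_continuous|exact: continuous_pr2].
have hu u : continuous ((fun v => h (u, v)) : _ -> R[i]^o).
  by apply: (continuous_pairing hc) ; [exact: cst_continuous|exact: continuous_idfun].
have M0 : 0 <= M.
  have := le_trans (modc_ge0 _) (hM 0 0); rewrite /oneDsqr expr0n addr0 divr1.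
  suff -> : weight (0 : 'rV[R]_n.+1) = 1 by rewrite mulr1.
  by apply: big1 => k _; rewrite mxE /oneDsqr expr0n addr0 invr1.
apply: (etrans (cintegral_swap (M := (2 * pi) ^+ n * M)
  (h := fun p => integral_rV (fun v => h (p.1, cons_rv p.2 v))) _ _)); last first.
- congr cintegral; apply/funext => w /=.
  apply: (IH M (fun p => h (p.1, cons_rv w p.2))) => // u v /=.
  apply: le_trans (hM _ _) _; rewrite weight_cons.
  rewrite ler_wpM2l ?mulr_ge0 ?oneDsqrV_ge0 // ler_piMl ?weight_ge0 //.
  exact: invr_oneDsqr_le1.
- move=> u w /=; rewrite -!mulrA; apply: modc_integral_rV_le.
    exact: (@continuous_cons_slice n (fun v => h (u, v)) w (hu u)).
  by move=> v; apply: le_trans (hM _ _) _; rewrite weight_cons !mulrA.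
- apply: (@continuous_integral_rV_param (R * R)%type n M
    (fun p : (R * R) * 'rV[R]_n => h (p.1.1, cons_rv p.1.2 p.2))).
    exact: continuous_slice.
  move=> [u w] v /=; apply: le_trans (hM _ _) _; rewrite weight_cons.
  rewrite mulrA ler_wpM2r ?weight_ge0 // -mulrA ler_piMr // mulr_ile1 //;
    by rewrite ?oneDsqrV_ge0 ?invr_oneDsqr_le1.
Qed.

End IteratedIntegral.

(** * The fundamental theorem on the line and the Poisson kernel *)

Section FundamentalTheorem.
Variable R : realType.
Local Notation mu := (@lebesgue_measure R).

Lemma is_derive_continuous (f f' : R -> R) :
  (forall u : R, is_derive u (1 : R) f (f' u)) -> continuous f.
Proof.
move=> fd u; apply: differentiable_continuous; apply/derivable1_diffP.
by have [] := fd u.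
Qed.

Lemma Rintegral_segment (phi Phi phi1 : R -> R) a b : a < b ->
  (forall u : R, is_derive u (1 : R) Phi (phi1 u)) -> continuous phi1 ->
  (forall u, a <= u <= b -> phi u = phi1 u) ->
  Rintegral mu `[a, b] phi = Phi b - Phi a.
Proof.
move=> ab dPhi c1 e1; have cPhi := is_derive_continuous dPhi.
have -> : Rintegral mu `[a, b] phi = Rintegral mu `[a, b] phi1.
  by apply: eq_Rintegral => u; rewrite inE /= in_itv /=; exact: e1.
rewrite /Rintegral (@continuous_FTC2 _ phi1 Phi a b ab) //.
- exact: continuous_subspaceT.
- split.
  + by move=> u _; have [] := dPhi u.
  + by apply: cvg_at_right_filter; exact: cPhi.
  + by apply: cvg_at_left_filter; exact: cPhi.
- by move=> u _; rewrite derive1E; apply: derive_val.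
Qed.

Lemma cvg_Rintegral_segments (phi : R -> R) M : continuous phi ->
  (forall u, `|phi u| <= M / oneDsqr u) ->
  Rintegral mu `[- m%:R, m%:R] phi @[m --> \oo] --> Rintegral mu setT phi.
Proof.
move=> cphi phiM.
have mphi : measurable_fun setT phi by exact: continuous_measurable_fun.
under eq_cvg do rewrite Rintegral_mkcond.
apply: (@cvg_Rintegral_dominated _ _ _ M).
- move=> m; apply: (measurable_restrictT phi (measurable_itv _)).1.
  exact: measurable_funTS.
- move=> m u; rewrite /patch; case: ifP => // _.
  by rewrite normr0 (le_trans (normr_ge0 _) (phiM u)).
- move=> u; apply: cvg_near_cst; near=> m.
  rewrite /patch ifT // inE /= in_itv /= -ler_norml.
  by near: m; exact: nbhs_infty_ger.
Unshelve. all: by end_near. Qed.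

(** The antiderivatives on the two half-lines may differ, so that the integrand
may have a kink at the origin. *)
Lemma Rintegral_line (phi Phi1 phi1 Phi2 phi2 : R -> R) l1 l2 M :
  continuous phi -> (forall u, `|phi u| <= M / oneDsqr u) ->
  (forall u : R, is_derive u (1 : R) Phi1 (phi1 u)) -> continuous phi1 ->
  (forall u, 0 <= u -> phi u = phi1 u) ->
  (forall u : R, is_derive u (1 : R) Phi2 (phi2 u)) -> continuous phi2 ->
  (forall u, u <= 0 -> phi u = phi2 u) ->
  Phi1 m%:R @[m --> \oo] --> l1 -> Phi2 (- m%:R) @[m --> \oo] --> l2 ->
  Rintegral mu setT phi = (Phi2 0 - l2) + (l1 - Phi1 0).
Proof.
move=> cphi phiM d1 c1 e1 d2 c2 e2 h1 h2.
apply: (cvg_unique _ (cvg_Rintegral_segments cphi phiM)) => //.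
apply: cvg_trans (cvgD (cvgB (cvg_cst (Phi2 0)) h2) (cvgB h1 (cvg_cst (Phi1 0)))).
apply: near_eq_cvg; near=> m.
have m0 : 0 < m%:R :> R by rewrite ltr0n; near: m; exact: nbhs_infty_gt.
have ip : mu.-integrable setT (EFin \o phi).
  by apply: (integrable_dominated _ phiM); exact: continuous_measurable_fun.
rewrite -[LHS]/((Phi2 0 - Phi2 (- m%:R)) + (Phi1 m%:R - Phi1 0)).
rewrite -(Rintegral_segment (phi := phi) _ d2 c2) ?oppr_lt0 //; last first.
  by move=> u /andP[_]; exact: e2.
rewrite -(Rintegral_segment (phi := phi) _ d1 c1) //; last first.
  by move=> u /andP[+ _]; exact: e1.
rewrite -(Rintegral_itv_obnd_cbnd (r := 0)); last exact: integrableS ip.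
rewrite -(@Rintegral_itvB _ phi (BLeft (- m%:R)) (BRight m%:R) 0).
- by rewrite addrC subrK.
- exact: integrableS ip.
- by rewrite bnd_simp oppr_le0 ltW.
- by rewrite bnd_simp ltW.
Unshelve. all: by end_near. Qed.

Lemma oneDsqrV_natr_cvg0 M : M / oneDsqr m%:R @[m --> \oo] --> (0 : R).
Proof.
rewrite -(mulr0 M); apply: cvgM; first exact: cvg_cst.
apply: (@squeeze_cvgr _ _ _ _ (cst 0) (fun m => m.+1%:R^-1)); last 2 first.
- exact: cvg_cst.
- by have := @cvg_harmonic R; apply.
apply: nearW => m; rewrite oneDsqrV_ge0 /= lef_pV2 ?posrE ?ltr0n //.
  rewrite /oneDsqr -natr1 addrC lerD2l -natrX ler_nat.
  by case: m => // m; rewrite leq_pmulr.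
Qed.

(** The boundary terms vanish; applied to a product, this is integration by
parts on the line. *)
Lemma Rintegral_derive_eq0 (Phi phi : R -> R) M M' :
  (forall u : R, is_derive u (1 : R) Phi (phi u)) -> continuous phi ->
  (forall u, `|phi u| <= M / oneDsqr u) ->
  (forall u, `|Phi u| <= M' / oneDsqr u) ->
  Rintegral mu setT phi = 0.
Proof.
move=> d c phiM PhiM.
rewrite (@Rintegral_line phi Phi phi Phi phi 0 0 M) //.
- by rewrite subr0 sub0r subrr.
- apply: norm_cvg0; apply: (@squeeze_cvgr _ _ _ _ (cst 0) (fun m => M' / oneDsqr m%:R)).
  + by apply: nearW => m; rewrite normr_ge0 PhiM.
  + exact: cvg_cst.
  + exact: oneDsqrV_natr_cvg0.
- apply: norm_cvg0; apply: (@squeeze_cvgr _ _ _ _ (cst 0) (fun m => M' / oneDsqr m%:R)).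
  + apply: nearW => m; rewrite normr_ge0 /=.
    by apply: le_trans (PhiM _) _; rewrite /oneDsqr sqrrN.
  + exact: cvg_cst.
  + exact: oneDsqrV_natr_cvg0.
Qed.

End FundamentalTheorem.

Section PoissonKernel.
Variable R : realType.

Lemma expR_neg_abs_le (u : R) : expR (- `|u|) <= 2 / oneDsqr u.
Proof.
have h := expR_ge1Dxn 1 (normr_ge0 u).
have o0 : 0 < oneDsqr u by rewrite (lt_le_trans ltr01) ?oneDsqr_ge1.
rewrite expRN -[leRHS]invrK invf_div lef_pV2 ?posrE ?expR_gt0 ?divr_gt0 //.
apply: le_trans h; rewrite /oneDsqr real_normK ?num_real //=.
have : 0 <= u ^+ 2 by exact: sqr_ge0.
rewrite (_ : 2`!%:R = 2 :> R) //; lra.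
Qed.

Lemma continuous_expR_neg_abs : continuous (fun u : R => expR (- `|u|)).
Proof.
apply: (continuous_compose (f := fun u : R => - `|u|)); last exact: continuous_expR.
by move=> u; apply: cvgN; exact: norm_continuous.
Qed.

Lemma continuous_mulr_cst (s : R) : continuous (fun u : R => u * s).
Proof. by move=> u; apply: cvgM; [exact: cvg_id|exact: cvg_cst]. Qed.

Lemma Rintegral_cos_expR (s : R) :
  Rintegral lebesgue_measure setT (fun u : R => cos (u * s) * expR (- `|u|)) =
  2 / oneDsqr s.
Proof.
have o0 : oneDsqr s != 0 by rewrite gt_eqF // (lt_le_trans ltr01) ?oneDsqr_ge1.
have ccos : continuous (fun u : R => cos (u * s)).
  by apply: continuous_compose (@continuous_cos R); exact: continuous_mulr_cst.
(* antiderivatives on the two half-lines, by two integrations by parts *)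
pose phi1 (u : R) := cos (u * s) * expR (- u).
pose phi2 (u : R) := cos (u * s) * expR u.
pose Phi1 (u : R) := (oneDsqr s)^-1 * (expR (- u) * (s * sin (u * s) - cos (u * s))).
pose Phi2 (u : R) := (oneDsqr s)^-1 * (expR u * (s * sin (u * s) + cos (u * s))).
have d1 (u : R) : is_derive u (1 : R) Phi1 (phi1 u).
  apply: is_derive_eq; rewrite /phi1 /GRing.scale /= ?scaler0 ?addr0 ?add0r ?mulr1.
  by apply: (mulfI o0); rewrite mulVKf // /oneDsqr; ring.
have d2 (u : R) : is_derive u (1 : R) Phi2 (phi2 u).
  apply: is_derive_eq; rewrite /phi2 /GRing.scale /= ?scaler0 ?addr0 ?add0r ?mulr1.
  by apply: (mulfI o0); rewrite mulVKf // /oneDsqr; ring.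
have cvg0 (F : nat -> R) : (forall m, `|F m| <= (1 + `|s|) * expR (- m%:R)) ->
    (oneDsqr s)^-1 * F m @[m --> \oo] --> (0 : R).
  move=> Fb; rewrite -(mulr0 (oneDsqr s)^-1); apply: cvgM; first exact: cvg_cst.
  apply: norm_cvg0; apply: (@squeeze_cvgr _ _ _ _ (cst 0)
    (fun m => (1 + `|s|) * expR (- m%:R))); last 2 first.
  - exact: cvg_cst.
  - rewrite -(mulr0 (1 + `|s|)); apply: cvgM; first exact: cvg_cst.
    exact: cvgn_expR.
  by apply: nearW => m; rewrite normr_ge0 Fb.
have trig (a b : R) : `|b| <= 1 -> `|s * sin a + b * cos a| <= 1 + `|s|.
  move=> b1; apply: le_trans (ler_normD _ _) _; rewrite addrC !normrM lerD //.
    by rewrite mulr_ile1 // ler_norml cos_geN1 cos_le1.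
  by rewrite ler_piMr // ler_norml sin_geN1 sin_le1.
rewrite (@Rintegral_line _ _ Phi1 phi1 Phi2 phi2 0 0 2) //.
- by rewrite /Phi1 /Phi2 oppr0 mul0r expR0 sin0 cos0; field.
- move=> u; apply: cvgM; [exact: ccos|exact: continuous_expR_neg_abs].
- move=> u; rewrite normrM (ger0_norm (expR_ge0 _)).
  apply: le_trans (expR_neg_abs_le u); rewrite ler_piMl ?expR_ge0 //.
  by rewrite ler_norml cos_geN1 cos_le1.
- move=> u; apply: cvgM; first exact: ccos.
  apply: (continuous_compose (f := fun u : R => - u)); last exact: continuous_expR.
  by move=> v; exact: cvgN.
- by move=> u u0; rewrite /phi1 ger0_norm.
- move=> u; apply: cvgM; first exact: ccos.
  exact: continuous_expR.
- by move=> u u0; rewrite /phi2 ler0_norm // opprK.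
- apply: cvg0 => m; rewrite normrM ger0_norm ?expR_ge0 // mulrC.
  by rewrite ler_wpM2r ?expR_ge0 // -mulN1r trig // normrN normr1.
- apply: cvg0 => m; rewrite normrM ger0_norm ?expR_ge0 // mulrC.
  by rewrite ler_wpM2r ?expR_ge0 // -[cos _]mul1r trig // normr1.
Qed.

Lemma Rintegral_sin_expR (s : R) :
  Rintegral lebesgue_measure setT (fun u : R => sin (u * s) * expR (- `|u|)) = 0.
Proof.
pose f (u : R) := sin (u * s) * expR (- `|u|).
have fc : continuous f.
  move=> u; apply: cvgM; last exact: continuous_expR_neg_abs.
  by apply: (continuous_compose (@continuous_mulr_cst s) (@continuous_sin R)).
have fi : lebesgue_measure.-integrable setT (EFin \o f).
  apply: (@integrable_dominated _ _ 2); first exact: continuous_measurable_fun.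
  move=> u; rewrite normrM (ger0_norm (expR_ge0 _)).
  apply: le_trans (expR_neg_abs_le u); rewrite ler_piMl ?expR_ge0 //.
  by rewrite ler_norml sin_geN1 sin_le1.
(* the integrand is odd *)
have : Rintegral lebesgue_measure setT f = - Rintegral lebesgue_measure setT f.
  rewrite -[LHS]Rintegral_opp // -mulN1r -RintegralZl //.
  by apply: eq_Rintegral => u _; rewrite /f mulNr sinN normrN mulN1r mulNr.
rewrite -/f; lra.
Qed.

Lemma fourier_expR_neg_abs (s : R) :
  cintegral (fun u => expi (u * s) * (expR (- `|u|))%:C) = (2 / oneDsqr s)%:C.
Proof.
apply: complexP => /=.
- rewrite -Rintegral_cos_expR; apply: eq_Rintegral => u _ /=.
  by rewrite mulr0 subr0.
- rewrite -(Rintegral_sin_expR s); apply: eq_Rintegral => u _ /=.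
  by rewrite mulr0 add0r.
Qed.

Lemma fourier_expR_neg_abs_scale (e s : R) : 0 < e ->
  cintegral (fun u => expi (u * s) * (expR (- (e * `|u|)))%:C) =
  (e^-1 * (2 / oneDsqr (s / e)))%:C.
Proof.
move=> e0; rewrite rmorphM /= -fourier_expR_neg_abs -(cintegral_affine 0 e0).
  congr cintegral; apply/funext => u; rewrite addr0 normrM (gtr0_norm e0).
  by congr (expi _ * _); field; rewrite gt_eqF.
apply: continuousMc.
- by apply: continuous_expi; exact: continuous_mulr_cst.
- by apply: continuous_realc; exact: continuous_expR_neg_abs.
Qed.

End PoissonKernel.

(** * Fourier inversion in one variable *)

Section OneVariable.
Variable R : realType.
Implicit Types (f : R -> R[i]) (M : R).

Definition fourier1 f (xi : R) : R[i] := cintegral (fun u => expi (xi * u) * f u).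

Definition is_cderive f f' := forall u : R,
  is_derive u (1 : R) (@complex.Re R \o f) (complex.Re (f' u)) /\
  is_derive u (1 : R) (@complex.Im R \o f) (complex.Im (f' u)).

Lemma dominated1_expi M f (a : R -> R) :
  dominated1 M f -> dominated1 M (fun u => expi (a u) * f u).
Proof. by move=> fM u; rewrite modcM modc_expi mul1r. Qed.

Lemma continuous_expi_mul (xi : R) f : continuous (f : R -> R[i]^o) ->
  continuous ((fun u => expi (xi * u) * f u) : R -> R[i]^o).
Proof.
move=> fc; apply: continuousMc fc; apply: continuous_expi.
by move=> u; apply: cvgM; [exact: cvg_cst|exact: cvg_id].
Qed.

Lemma cintegral_derive_eq0 f f' M M' : is_cderive f f' ->
  continuous (f' : R -> R[i]^o) -> dominated1 M f -> dominated1 M' f' ->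
  cintegral f' = 0.
Proof.
move=> fd fc fM fM'; apply: complexP; rewrite /cintegral /=.
- apply: (@Rintegral_derive_eq0 _ (@complex.Re R \o f) _ M' M).
  + by move=> u; have [] := fd u.
  + exact: continuous_Re.
  + by move=> u; exact: dominated1_Re.
  + by move=> u; exact: (dominated1_Re u fM).
- apply: (@Rintegral_derive_eq0 _ (@complex.Im R \o f) _ M' M).
  + by move=> u; have [] := fd u.
  + exact: continuous_Im.
  + by move=> u; exact: dominated1_Im.
  + by move=> u; exact: (dominated1_Im u fM).
Qed.

Lemma is_cderive_continuous f f' : is_cderive f f' ->
  continuous (f : R -> R[i]^o).
Proof.
move=> fd; apply/continuous_ReIm; split.
- by apply: (is_derive_continuous (f' := fun u => complex.Re (f' u))) => u; have [] := fd u.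
- by apply: (is_derive_continuous (f' := fun u => complex.Im (f' u))) => u; have [] := fd u.
Qed.

Lemma is_cderive_expi_mul (xi : R) f f' : is_cderive f f' ->
  is_cderive (fun u => expi (xi * u) * f u)
    (fun u => (0 +i* xi) * (expi (xi * u) * f u) + expi (xi * u) * f' u).
Proof.
move=> fd u; have [dr di] := fd u; split.
- rewrite (_ : _ \o _ = fun v : R => cos (xi * v) * (@complex.Re R \o f) v
      - sin (xi * v) * (@complex.Im R \o f) v); last first.
    by apply/funext => v /=; rewrite ReM.
  apply: is_derive_eq; rewrite ReD !ReM !ImM /GRing.scale /=; ring.
- rewrite (_ : _ \o _ = fun v : R => cos (xi * v) * (@complex.Im R \o f) v
      + sin (xi * v) * (@complex.Re R \o f) v); last first.
    by apply/funext => v /=; rewrite ImM.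
  apply: is_derive_eq; rewrite ImD !ImM !ReM /GRing.scale /=; ring.
Qed.

(** The derivative of [e^(i xi u) f(u)] has integral 0. *)
Lemma fourier1_derive f f' M M' (xi : R) : is_cderive f f' ->
  continuous (f' : R -> R[i]^o) -> dominated1 M f -> dominated1 M' f' ->
  fourier1 f' xi = - (0 +i* xi) * fourier1 f xi.
Proof.
move=> fd fc fM fM'; have cf := is_cderive_continuous fd.
have c1 := @continuous_expi_mul xi f cf; have c2 := @continuous_expi_mul xi f' fc.
have ci : continuous ((fun u => (0 +i* xi) * (expi (xi * u) * f u)) : R -> R[i]^o).
  exact: (continuousMc (@cst_continuous _ _ _) c1).
have di : dominated1 (modc (0 +i* xi) * M) (fun u => (0 +i* xi) * (expi (xi * u) * f u)).
  move=> u; rewrite modcM -mulrA ler_wpM2l ?modc_ge0 //.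
  exact: (dominated1_expi (fun u => xi * u) fM).
have d2 := dominated1_expi (fun u => xi * u) fM'.
have d1 := dominated1_expi (fun u => xi * u) fM.
have cs : continuous ((fun u => (0 +i* xi) * (expi (xi * u) * f u)
    + expi (xi * u) * f' u) : R -> R[i]^o).
  by move=> u; apply: (@cvgD R[i]); [exact: ci|exact: c2].
have ds : dominated1 (modc (0 +i* xi) * M + M')
    (fun u => (0 +i* xi) * (expi (xi * u) * f u) + expi (xi * u) * f' u).
  move=> u; apply: le_trans (modcD _ _) _; rewrite mulrDl.
  by apply: lerD; [exact: di|exact: d2].
have := cintegral_derive_eq0 (is_cderive_expi_mul xi fd) cs d1 ds.
rewrite (cintegralD ci di c2 d2) (cintegralZ _ c1 d1) => h.
by apply/eqP; rewrite mulNr -addr_eq0 addrC; exact/eqP.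
Qed.

(** The transform of [f''] is [- xi^2] times that of [f], so [(1 + xi^2) F f] is
bounded. *)
Lemma fourier1_dominated f f' f'' M0 M1 M2 :
  is_cderive f f' -> is_cderive f' f'' -> continuous (f'' : R -> R[i]^o) ->
  dominated1 M0 f -> dominated1 M1 f' -> dominated1 M2 f'' ->
  dominated1 (2 * pi * (M0 + M2)) (fourier1 f).
Proof.
move=> d0 d1 c2 b0 b1 b2 xi; have c1 := is_cderive_continuous d1.
have c0 := is_cderive_continuous d0.
have e2 : fourier1 f'' xi = - (xi ^+ 2)%:C * fourier1 f xi.
  rewrite (fourier1_derive xi d1 c2 b1 b2) (fourier1_derive xi d0 c1 b0 b1) mulrA.
  by congr (_ * _); apply: complexP; rewrite /= ?mul0r ?mulr0 ?oppr0; ring.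
have bd g M : continuous (g : R -> R[i]^o) -> dominated1 M g ->
    modc (fourier1 g xi) <= 2 * pi * M.
  move=> gc gM; apply: modc_cintegral_le; first exact: continuous_expi_mul.
  exact: (dominated1_expi (fun u => xi * u)).
rewrite ler_pdivlMr ?(lt_le_trans ltr01) ?oneDsqr_ge1 // mulrC /oneDsqr.
rewrite mulrDl mul1r mulrDr lerD ?bd //.
have := bd _ _ c2 b2; rewrite e2 modcM.
suff -> : modc (- (xi ^+ 2)%:C) = xi ^+ 2 by [].
by rewrite -rmorphN modcR normrN normrX real_normK ?num_real.
Qed.

Lemma continuous_fourier1 f M : continuous (f : R -> R[i]^o) ->
  dominated1 M f -> continuous (fourier1 f : R -> R[i]^o).
Proof.
move=> fc fM.
apply: (@continuous_cintegral_param R R (fun p => expi (p.1 * p.2) * f p.2) M).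
  apply: continuousMc.
    apply: continuous_expi => p; apply: cvgM; [exact: continuous_pr1|exact: continuous_pr2].
  exact: continuous_compose (@continuous_pr2 _ _) fc.
by move=> t; exact: (dominated1_expi (fun u => t * u)).
Qed.

Lemma expR_neg_abs_scale_le (e u : R) : 0 < e -> e <= 1 ->
  expR (- (e * `|u|)) <= 2 / e ^+ 2 / oneDsqr u.
Proof.
move=> e0 e1; have := expR_neg_abs_le (e * u); rewrite normrM (gtr0_norm e0).
move=> /le_trans; apply; rewrite -mulrA ler_wpM2l // -invfM lef_pV2.
- rewrite /oneDsqr exprMn mulrDr mulr1 lerD2r expr_le1 // ltW //.
- by rewrite posrE (lt_le_trans ltr01) ?oneDsqr_ge1.
- by rewrite posrE mulr_gt0 ?exprn_gt0 // (lt_le_trans ltr01) ?oneDsqr_ge1.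
Qed.

Lemma cintegral_oneDsqrV : cintegral (fun v : R => (2 / oneDsqr v)%:C) = (2 * pi)%:C.
Proof.
apply: complexP; rewrite /cintegral /=; first exact: Rintegral_oneDsqrV.
by rewrite /Rintegral /comp /= integral0.
Qed.

(** By Fubini's theorem, the Fourier transform at [x] of the damped function
[e^(- e |xi|) F f (xi)] is [2 pi] times the convolution of [f] with the Poisson
kernel at scale [e], taken at [- x]; it is written with the kernel rescaled to
unit scale, so that only the argument of [f] depends on [e]. *)
Lemma fourier1_damped f M (x e : R) : continuous (f : R -> R[i]^o) ->
  dominated1 M f -> 0 < e -> e <= 1 ->
  cintegral (fun xi => expi (x * xi) * ((expR (- (e * `|xi|)))%:C * fourier1 f xi)) =
  cintegral (fun v => (2 / oneDsqr v)%:C * f (e * v - x)).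
Proof.
move=> fc fM e0 e1.
have cdamp : continuous (fun u : R => expR (- (e * `|u|))).
  apply: (continuous_compose (f := fun u : R => - (e * `|u|))); last exact: continuous_expR.
  by move=> u; apply: cvgN; apply: cvgM; [exact: cvg_cst|exact: norm_continuous].
(* the integrand at [(xi, u)] of a double integral; integrating in [xi] first
gives the Poisson kernel at [x + u] *)
pose h (p : R * R) := (expi (p.1 * (x + p.2)) * (expR (- (e * `|p.1|)))%:C) * f p.2.
have hc : continuous (h : _ -> R[i]^o).
  apply: continuousMc; last exact: continuous_compose (@continuous_pr2 _ _) fc.
  apply: continuousMc.
    apply: continuous_expi => p; apply: cvgM; first exact: continuous_pr1.
    by apply: cvgD; [exact: cvg_cst|exact: continuous_pr2].
  by apply: continuous_realc; exact: continuous_compose (@continuous_pr1 _ _) cdamp.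
have M0 : 0 <= M.
  have := le_trans (modc_ge0 _) (fM 0).
  by rewrite /oneDsqr expr0n addr0 divr1.
have hM u v : modc (h (u, v)) <= (2 / e ^+ 2 * M) / oneDsqr u / oneDsqr v.
  rewrite /h /= !modcM modc_expi mul1r modcR ger0_norm ?expR_ge0 //.
  have -> : 2 / e ^+ 2 * M / oneDsqr u / oneDsqr v =
    (2 / e ^+ 2 / oneDsqr u) * (M / oneDsqr v) by ring.
  by apply: ler_pM; rewrite ?expR_ge0 ?modc_ge0 ?expR_neg_abs_scale_le.
transitivity (cintegral (fun u => cintegral (fun v => h (u, v)))).
  congr cintegral; apply/funext => xi; rewrite mulrA.
  rewrite -(cintegralZ _ (@continuous_expi_mul xi f fc) (M := M)); last first.
    exact: (dominated1_expi (fun u => xi * u)).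
  congr cintegral; apply/funext => v; rewrite /h /=.
  rewrite (mulrC x) mulrDr expiD; ring.
rewrite (cintegral_swap hc hM).
transitivity (cintegral (fun v => (e^-1 * (2 / oneDsqr ((x + v) / e)))%:C * f v)).
  congr cintegral; apply/funext => v; rewrite /h /=.
  rewrite -(fourier_expR_neg_abs_scale (x + v) e0) mulrC.
  rewrite -(cintegralZ (M := 2 / e ^+ 2)).
  - by congr cintegral; apply/funext => u; rewrite mulrC.
  - apply: continuousMc; last exact: continuous_realc.
    by apply: continuous_expi; exact: continuous_mulr_cst.
  - move=> u; rewrite modcM modc_expi mul1r modcR ger0_norm ?expR_ge0 //.
    exact: expR_neg_abs_scale_le.
pose g v := (e^-1 * (2 / oneDsqr ((x + v) / e)))%:C * f v.
have cP : continuous (fun v : R => e^-1 * (2 / oneDsqr ((x + v) / e))).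
  move=> v; apply: cvgM; first exact: cvg_cst.
  apply: cvgM; first exact: cvg_cst.
  apply: (continuous_compose (f := fun v : R => (x + v) / e) (g := fun u => (oneDsqr u)^-1)).
    by move=> w; apply: cvgM; [apply: cvgD; [exact: cvg_cst|exact: cvg_id]|exact: cvg_cst].
  exact: continuous_oneDsqrV.
have gc : continuous (g : R -> R[i]^o).
  by apply: continuousMc fc; exact: continuous_realc.
have ne : e != 0 by rewrite gt_eqF.
have gM : dominated1 (e^-1 * 2 * M) g.
  move=> v; rewrite modcM modcR ger0_norm ?mulr_ge0 ?invr_ge0 ?oneDsqrV_ge0 ?(ltW e0) //.
  have -> : e^-1 * 2 * M / oneDsqr v = e^-1 * 2 * (M / oneDsqr v) by ring.
  apply: ler_pM => //; rewrite ?modc_ge0 ?mulr_ge0 ?invr_ge0 ?oneDsqrV_ge0 ?(ltW e0) //.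
  by rewrite mulrA ler_piMr ?mulr_ge0 ?invr_ge0 ?invr_oneDsqr_le1 ?(ltW e0) .
have := cintegral_affine (- x) e0 gc.
move=> /(congr1 (fun z => e%:C * z)); rewrite mulrA -rmorphM /= divff // mul1r.
rewrite -/g => <-.
rewrite -(cintegralZ (M := e^-1 * (2 * M))).
- congr cintegral; apply/funext => v; rewrite /g mulrA -rmorphM; congr (_%:C * _).
  rewrite (_ : (x + (e * v - x)) / e = v) ?mulrA ?divff ?mul1r //.
  by field.
- apply: continuous_compose gc => v; apply: cvgD; last exact: cvg_cst.
  by apply: cvgM; [exact: cvg_cst|exact: cvg_id].
- move=> v; rewrite /g modcM modcR.
  rewrite (_ : (x + (e * v - x)) / e = v); last by field.
  rewrite ger0_norm ?mulr_ge0 ?invr_ge0 ?oneDsqrV_ge0 ?(ltW e0) //.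
  have -> : e^-1 * (2 * M) / oneDsqr v = e^-1 * (2 / oneDsqr v) * M by ring.
  rewrite ler_wpM2l ?mulr_ge0 ?invr_ge0 ?oneDsqrV_ge0 ?(ltW e0) //.
  by apply: le_trans (fM _) _; rewrite ler_piMr ?invr_oneDsqr_le1.
Qed.

(** Let [e] tend to 0 in [fourier1_damped]: by dominated convergence the left-hand
side tends to the double transform, and the right-hand side to [f (- x)] times
the integral [2 pi] of [2 / (1 + v^2)]. *)
Lemma fourier1_inversion f M M' (x : R) : continuous (f : R -> R[i]^o) ->
  dominated1 M f -> dominated1 M' (fourier1 f) ->
  fourier1 (fourier1 f) x = (2 * pi)%:C * f (- x).
Proof.
move=> fc fM FM.
have cF := continuous_fourier1 fc fM.
pose e (m : nat) : R := m.+1%:R^-1.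
have e0 m : 0 < e m by rewrite invr_gt0 ltr0n.
have e1 m : e m <= 1 by rewrite invf_le1 ?ltr0n // ler1n.
have ecv : e m @[m --> \oo] --> 0 by exact: cvg_harmonic.
pose k m (xi : R) : R[i] := expi (x * xi) * ((expR (- (e m * `|xi|)))%:C * fourier1 f xi).
pose j m (v : R) : R[i] := (2 / oneDsqr v)%:C * f (e m * v - x).
have kj m : cintegral (k m) = cintegral (j m) by exact: fourier1_damped.
have M0 : 0 <= M.
  have := le_trans (modc_ge0 _) (fM 0).
  by rewrite /oneDsqr expr0n addr0 divr1.
have cj : (cintegral (j m) : R[i]^o) @[m --> \oo] -->
    (cintegral (fun v => (2 / oneDsqr v)%:C * f (- x)) : R[i]^o).
  have jc m : continuous (j m : R -> R[i]^o).
    apply: continuousMc.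
      apply: continuous_realc => v; apply: cvgM; first exact: cvg_cst.
      exact: continuous_oneDsqrV.
    apply: continuous_compose fc => v; apply: cvgD; last exact: cvg_cst.
    by apply: cvgM; [exact: cvg_cst|exact: cvg_id].
  have jM m : dominated1 (2 * M) (j m).
    move=> v; rewrite modcM modcR ger0_norm ?mulr_ge0 ?oneDsqrV_ge0 //.
    have -> : 2 * M / oneDsqr v = 2 / oneDsqr v * M by ring.
    rewrite ler_wpM2l ?mulr_ge0 ?oneDsqrV_ge0 //.
    by apply: le_trans (fM _) _; rewrite ler_piMr ?invr_oneDsqr_le1.
  have ev v : e m * v - x @[m --> \oo] --> - x.
    rewrite -[X in _ --> X]add0r -(mul0r v).
    by apply: cvgB; [apply: cvgM => //; exact: cvg_cst|exact: cvg_cst].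
  apply: (cvg_cintegral jc jM) => v.
  - under eq_cvg do rewrite Re_realM.
    rewrite Re_realM; apply: cvgM; first exact: cvg_cst.
    exact: (cvg_comp _ _ (ev v) (continuous_Re fc (x := - x))).
  - under eq_cvg do rewrite Im_realM.
    rewrite Im_realM; apply: cvgM; first exact: cvg_cst.
    exact: (cvg_comp _ _ (ev v) (continuous_Im fc (x := - x))).
have ck : (cintegral (k m) : R[i]^o) @[m --> \oo] -->
    (fourier1 (fourier1 f) x : R[i]^o).
  have kc m : continuous (k m : R -> R[i]^o).
    apply: continuous_expi_mul; apply: continuousMc cF; apply: continuous_realc.
    apply: (continuous_compose (f := fun u : R => - (e m * `|u|))); last exact: continuous_expR.
    by move=> u; apply: cvgN; apply: cvgM; [exact: cvg_cst|exact: norm_continuous].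
  have kM m : dominated1 M' (k m).
    apply: (dominated1_expi (fun u => x * u)) => u; apply: le_trans (FM u).
    rewrite modcM modcR ger0_norm ?expR_ge0 // ler_piMl ?modc_ge0 //.
    by rewrite -expR0 ler_expR oppr_le0 mulr_ge0 // ltW.
  have ev xi : expR (- (e m * `|xi|)) @[m --> \oo] --> (1 : R).
    have h : - (e m * `|xi|) @[m --> \oo] --> (0 : R).
      rewrite -[X in _ --> X]oppr0 -(mul0r `|xi|).
      by apply: cvgN; apply: cvgM => //; exact: cvg_cst.
    by rewrite -expR0; exact: (cvg_comp _ _ h (continuous_expR (x := 0))).
  apply: (cvg_cintegral kc kM) => xi.
  - rewrite (_ : (fun m => complex.Re (k m xi)) = fun m => expR (- (e m * `|xi|)) *
      complex.Re (expi (x * xi) * fourier1 f xi)); last first.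
      by apply/funext => m; rewrite -Re_realM mulrCA.
    by rewrite -[X in _ --> X]mul1r; apply: cvgM => //; exact: cvg_cst.
  - rewrite (_ : (fun m => complex.Im (k m xi)) = fun m => expR (- (e m * `|xi|)) *
      complex.Im (expi (x * xi) * fourier1 f xi)); last first.
      by apply/funext => m; rewrite -Im_realM mulrCA.
    by rewrite -[X in _ --> X]mul1r; apply: cvgM => //; exact: cvg_cst.
have -> : fourier1 (fourier1 f) x =
    cintegral (fun v => (2 / oneDsqr v)%:C * f (- x)).
  have kjE : (fun m => cintegral (k m)) = (fun m => cintegral (j m)).
    by apply/funext => m; exact: kj.
  rewrite kjE in ck.
  exact: (@norm_cvg_unique R[i] (R[i])^o _ _ _ _ ck cj).
rewrite -cintegral_oneDsqrV mulrC -(cintegralZ (M := 2)).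
- by congr cintegral; apply/funext => v; rewrite mulrC.
- by apply: continuous_realc => v; apply: cvgM; [exact: cvg_cst|exact: continuous_oneDsqrV].
- by move=> v; rewrite modcR ger0_norm ?mulr_ge0 ?oneDsqrV_ge0.
Qed.

End OneVariable.

(** * Partial derivatives and the Schwartz space *)

Section PartialDerivatives.
Variable R : realType.

Lemma coord_le_norm n (x : 'rV[R]_n) k : `|x 0 k| <= `|x|.
Proof.
rewrite [leRHS]/Num.norm /= mx_normrE.
exact: (le_bigmax _ (fun i : 'I_1 * 'I_n => `|x i.1 i.2|) (0, k)).
Qed.

Lemma norm_rV_le n (x : 'rV[R]_n) c : 0 <= c -> (forall k, `|x 0 k| <= c) ->
  `|x| <= c.
Proof.
move=> c0 xc; rewrite /Num.norm /= mx_normrE; apply: bigmax_le => // -[i k] _ /=.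
by rewrite ord1.
Qed.

Lemma norm_cons_rv_ge_tail n u (v : 'rV[R]_n) : `|v| <= `|cons_rv u v|.
Proof.
apply: norm_rV_le => // k.
by have := coord_le_norm (cons_rv u v) (lift ord0 k); rewrite cons_rvS.
Qed.

(** A directional derivative sees only the restriction to a line; this is how
derivatives of several variables are reduced to one variable and to slices. *)
Lemma is_derive_transfer (V W : normedModType R) (f : V -> R) (g : W -> R)
    (x d : V) (y e : W) l : (forall t : R, f (t *: d + x) = g (t *: e + y)) ->
  is_derive y e g l -> is_derive x d f l.
Proof.
move=> fg [gd gl].
have fg0 : f x = g y by have := fg 0; rewrite !scale0r !add0r.
have E : (fun h : R => h^-1 *: ((f \o shift x) (h *: d) - f x)) =
    (fun h : R => h^-1 *: ((g \o shift y) (h *: e) - g y)).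
  by apply/funext => h /=; rewrite fg fg0.
by split; rewrite /derivable /derive E.
Qed.

Definition is_partial n (k : 'I_n) (f f' : 'rV[R]_n -> R[i]) := forall x,
  is_derive x (delta_mx 0 k) (@complex.Re R \o f) (complex.Re (f' x)) /\
  is_derive x (delta_mx 0 k) (@complex.Im R \o f) (complex.Im (f' x)).

Lemma is_partialP n (k : 'I_n) f f' : is_partial k f f' ->
  (forall x, partial_derivable k f x) /\ partial k f = f'.
Proof.
move=> fd; split=> [x|]; first by have [[? _] [? _]] := fd x.
by apply/funext => x; have [[_ er] [_ ei]] := fd x; apply: complexP.
Qed.

Lemma derivable_is_partial n (k : 'I_n) (f : 'rV[R]_n -> R[i]) :
  (forall x, partial_derivable k f x) -> is_partial k f (partial k f).
Proof. by move=> fd x; have [fr fi] := fd x; split; exact: derivableP. Qed.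

Lemma is_derive_lin (V : normedModType R) (x d : V) (f g : V -> R) (a b df dg : R) :
  is_derive x d f df -> is_derive x d g dg ->
  is_derive x d (fun y => a * f y + b * g y) (a * df + b * dg).
Proof.
by move=> fd gd; exact: (is_deriveD (is_deriveZ a fd) (is_deriveZ b gd)).
Qed.

Lemma is_partialZ n (k : 'I_n) f f' c : is_partial k f f' ->
  is_partial k (fun x => c * f x) (fun x => c * f' x).
Proof.
move=> fd x; have [fr fi] := fd x; split.
- rewrite (_ : _ \o _ = fun y => complex.Re c * (@complex.Re R \o f) y +
      (- complex.Im c) * (@complex.Im R \o f) y); last first.
    by apply/funext => y /=; rewrite ReM mulNr.
  by rewrite ReM -mulNr; exact: is_derive_lin.
- rewrite (_ : _ \o _ = fun y => complex.Re c * (@complex.Im R \o f) y +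
      complex.Im c * (@complex.Re R \o f) y); last first.
    by apply/funext => y /=; rewrite ImM.
  by rewrite ImM; exact: is_derive_lin.
Qed.

Lemma is_partialD n (k : 'I_n) f f' g g' : is_partial k f f' ->
  is_partial k g g' ->
  is_partial k (fun x => f x + g x) (fun x => f' x + g' x).
Proof.
move=> fd gd x; have [fr fi] := fd x; have [gr gi] := gd x; split.
- rewrite (_ : _ \o _ = fun y => (@complex.Re R \o f) y + (@complex.Re R \o g) y).
    by rewrite ReD; exact: (is_deriveD fr gr).
  by apply/funext => y /=; rewrite ReD.
- rewrite (_ : _ \o _ = fun y => (@complex.Im R \o f) y + (@complex.Im R \o g) y).
    by rewrite ImD; exact: (is_deriveD fi gi).
  by apply/funext => y /=; rewrite ImD.
Qed.

Lemma line_coord n (t : R) (d x : 'rV[R]_n) k :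
  (t *: d + x) 0 k = t * d 0 k + x 0 k.
Proof. by rewrite !mxE. Qed.

Lemma delta_coord n (k j : 'I_n) : (delta_mx 0 k : 'rV[R]_n) 0 j = (j == k)%:R.
Proof. by rewrite mxE eqxx. Qed.

Lemma delta_cons0 n (t u : R) (v : 'rV[R]_n) :
  t *: delta_mx 0 ord0 + cons_rv u v = cons_rv (t + u) v.
Proof.
apply: cons_rvP => [|k]; rewrite line_coord delta_coord ?cons_rv0 ?cons_rvS.
  by rewrite eqxx mulr1.
by rewrite eq_sym (negbTE (neq_lift _ _)) mulr0 add0r.
Qed.

Lemma delta_consS n (k : 'I_n) t u (v : 'rV[R]_n) :
  t *: delta_mx 0 (lift ord0 k) + cons_rv u v = cons_rv u (t *: delta_mx 0 k + v).
Proof.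
apply: cons_rvP => [|j]; rewrite line_coord delta_coord ?cons_rv0 ?cons_rvS.
  by rewrite (negbTE (neq_lift _ _)) mulr0 add0r.
by rewrite line_coord delta_coord (inj_eq lift_inj).
Qed.

Lemma is_partial_slice_head n (f f' : 'rV[R]_n.+1 -> R[i]) v :
  is_partial ord0 f f' ->
  is_cderive (fun u => f (cons_rv u v)) (fun u => f' (cons_rv u v)).
Proof.
move=> fd u; have [fr fi] := fd (cons_rv u v); split.
- apply: is_derive_transfer fr => t; rewrite delta_cons0.
  by rewrite /= /GRing.scale /= mulr1.
- apply: is_derive_transfer fi => t; rewrite delta_cons0.
  by rewrite /= /GRing.scale /= mulr1.
Qed.

Lemma is_partial_slice_tail n (k : 'I_n) (f f' : 'rV[R]_n.+1 -> R[i]) u :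
  is_partial (lift ord0 k) f f' ->
  is_partial k (fun v => f (cons_rv u v)) (fun v => f' (cons_rv u v)).
Proof.
move=> fd v; have [fr fi] := fd (cons_rv u v); split.
- by apply: is_derive_transfer fr => t; rewrite delta_consS.
- by apply: is_derive_transfer fi => t; rewrite delta_consS.
Qed.

(** Differentiation under the integral sign along the line [t |-> t d + v]. *)
Lemma is_derive_Rintegral_param n (k k' : R -> 'rV[R]_n -> R) (d : 'rV[R]_n)
    M M' v : (forall u w, is_derive w d (k u) (k' u w)) ->
  (forall w, continuous (k ^~ w)) ->
  (forall u w, `|k u w| <= M / oneDsqr u) ->
  (forall u w, `|k' u w| <= M' / oneDsqr u) ->
  is_derive v d (fun w => Rintegral lebesgue_measure setT (k ^~ w))
    (Rintegral lebesgue_measure setT (k' ^~ v)).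
Proof.
move=> kd kc kM kM'.
pose f (t : R) (u : R) := k u (t *: d + v).
have fd (t u : R) : is_derive t (1 : R) (f ^~ u) (k' u (t *: d + v)).
  apply: is_derive_transfer (kd u (t *: d + v)) => s.
  by rewrite /f -[s *: 1]/(s * 1) mulr1 scalerDl addrA.
have f'E t u : partial1of2 f t u = k' u (t *: d + v).
  by rewrite partial1of2E; have [] := fd t u.
have I0 : (`]- (1 : R), 1[%classic : set R) 0.
  by rewrite /= in_itv /= ltrN10 ltr01.
have intf t : (`]- (1 : R), 1[%classic : set R) t ->
    lebesgue_measure.-integrable setT (EFin \o f t).
  move=> _; apply: (@integrable_dominated _ _ M); last by move=> u; exact: kM.
  by apply: continuous_measurable_fun; exact: kc.
have derf t u : (`]- (1 : R), 1[%classic : set R) t -> (setT : set R) u ->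
    derivable (f ^~ u) t 1.
  by move=> _ _; have [] := fd t u.
have Gge u : 0 <= M' / oneDsqr u by exact: le_trans (normr_ge0 _) (kM' u v).
have Gub t u : (`]- (1 : R), 1[%classic : set R) t -> (setT : set R) u ->
    `|partial1of2 f t u| <= M' / oneDsqr u.
  by move=> _ _; rewrite f'E.
have D1 := @derivable_under_integral R _ _ lebesgue_measure f setT measurableT
  0 (- 1) 1 I0 intf derf _ Gge (integrable_oneDsqrV M') Gub.
have D2 := @differentiation_under_integral R _ _ lebesgue_measure f setT
  measurableT 0 (- 1) 1 I0 intf derf _ Gge (integrable_oneDsqrV M') Gub.
apply: (@is_derive_transfer _ R^o _ (fun t => Rintegral lebesgue_measure setT (f t))
  v d (0 : R) (1 : R)).
  by move=> t; rewrite addr0 -[t *: 1]/(t * 1) mulr1.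
split; first exact: D1.
rewrite -derive1E D2; apply: eq_Rintegral => u _.
by rewrite f'E scale0r add0r.
Qed.

End PartialDerivatives.

Section SchwartzSpace.
Variable R : realType.

Definition rapid n (h : 'rV[R]_n -> R[i]) := forall N, exists M,
  forall x, (1 + `|x|) ^+ N * modc (h x) <= M.

Lemma schwartz_norm_leE n N (f : 'rV[R]_n -> R[i]) e :
  schwartz_norm_le N f e <-> forall s : seq 'I_n, (size s <= N)%N ->
  forall x, (1 + `|x|) ^+ N * modc (partials s f x) <= e.
Proof.
by split=> h s sN x; have := h s sN x; rewrite modcE -rmorphM lecR.
Qed.

Lemma partials_rcons n (s : seq 'I_n) k (f : 'rV[R]_n -> R[i]) :
  partials (rcons s k) f = partials s (partial k f).
Proof. by rewrite /partials foldr_rcons. Qed.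

Lemma one_norm_ge1 n (x : 'rV[R]_n) : 1 <= 1 + `|x|.
Proof. by rewrite lerDl. Qed.

Lemma schwartz_partial n (k : 'I_n) (f : 'rV[R]_n -> R[i]) :
  schwartz f -> schwartz (partial k f).
Proof.
move=> [fs fN]; split=> [s|N]; first by rewrite -partials_rcons; exact: fs.
have [M /schwartz_norm_leE fM] := fN N.+1; exists M; apply/schwartz_norm_leE.
move=> s sN x; apply: le_trans (fM (rcons s k) _ x); last by rewrite size_rcons.
rewrite partials_rcons ler_wpM2r ?modc_ge0 // ler_weXn2l //.
exact: one_norm_ge1.
Qed.

Lemma schwartz_continuous n (f : 'rV[R]_n -> R[i]) : schwartz f ->
  continuous (f : _ -> R[i]^o).
Proof. by move=> [fs _]; have [] := fs [::]. Qed.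

Lemma schwartz_is_partial n (k : 'I_n) (f : 'rV[R]_n -> R[i]) : schwartz f ->
  is_partial k f (partial k f).
Proof.
move=> [fs _]; apply: derivable_is_partial => x; have [_] := fs [::]; exact.
Qed.

Lemma schwartz_rapid n (f : 'rV[R]_n -> R[i]) : schwartz f -> rapid f.
Proof.
move=> [_ fN] N; have [M /schwartz_norm_leE fM] := fN N; exists M => x.
exact: (fM [::]).
Qed.

(** There are finitely many words of length at most [N], so bounds for each word
give a common one; this is how a Schwartz norm, a supremum over words, is
bounded. *)
Lemma bounded_words (I : finType) (P : seq I -> R -> Prop) N :
  (forall s M M', M <= M' -> P s M -> P s M') ->
  (forall s, exists M, P s M) ->
  exists M, forall s, (size s <= N)%N -> P s M.
Proof.
elim: N P => [|N IH] P Pmono Pex.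
  by have [M PM] := Pex [::]; exists M => s; rewrite leqn0 size_eq0 => /eqP ->.
have /choice [M PM] : forall i, exists M, forall s, (size s <= N)%N -> P (i :: s) M.
  by move=> i; apply: (IH (fun s => P (i :: s))) => [s|s]; [exact: Pmono|exact: Pex].
have [M0 PM0] := Pex [::].
exists (`|M0| + \sum_i `|M i|) => -[|i s] sN.
  apply: Pmono PM0; apply: le_trans (ler_norm _) _; rewrite lerDl.
  exact: sumr_ge0.
apply: Pmono (PM i s sN); apply: le_trans (ler_norm _) _.
rewrite (bigD1 i) //= addrCA lerDl addr_ge0 // sumr_ge0 //.
Qed.

(** The Schwartz space is the largest set of continuous rapidly decreasing
functions that is stable under the partial derivatives; membership is proved by
exhibiting any such set, and the second conclusion gives all derivatives the
properties shared by the elements of the set. *)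
Lemma schwartz_coinduction n (A : ('rV[R]_n -> R[i]) -> Prop) :
  (forall h, A h -> continuous (h : _ -> R[i]^o)) -> (forall h, A h -> rapid h) ->
  (forall h k, A h -> exists2 h', A h' & is_partial k h h') ->
  forall h, A h -> schwartz h /\ forall s, A (partials s h).
Proof.
move=> Ac Ar Ad h Ah.
have As s : A (partials s h).
  elim: s => [//|k s IH]; have [h' Ah' /is_partialP[_]] := Ad _ k IH.
  by rewrite /= /partials /= => ->.
split=> //; split=> [s|N].
  split=> [|k]; first exact: Ac.
  by have [h' _ /is_partialP[]] := Ad _ k (As s).
have [||M hM] := @bounded_words 'I_n (fun s M => forall x,
  (1 + `|x|) ^+ N * modc (partials s h x) <= M) N.
- by move=> s M M' MM' PM x; exact: le_trans (PM x) MM'.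
- by move=> s; exact: Ar.
- by exists M; apply/schwartz_norm_leE.
Qed.

Lemma rapidZ n c (h : 'rV[R]_n -> R[i]) : rapid h -> rapid (fun x => c * h x).
Proof.
move=> hr N; have [M hM] := hr N; exists (modc c * M) => x.
by rewrite modcM mulrCA ler_wpM2l ?modc_ge0.
Qed.

Lemma schwartzZ n c (h : 'rV[R]_n -> R[i]) : schwartz h ->
  schwartz (fun x => c * h x).
Proof.
move=> hs; apply: (proj1 (schwartz_coinduction
  (A := fun g => exists2 h, schwartz h & g = fun x => c * h x) _ _ _ _)); last by exists h.
- move=> _ [g gs ->]; apply: continuousMc; first exact: cst_continuous.
  exact: schwartz_continuous.
- by move=> _ [g gs ->]; apply: rapidZ; exact: schwartz_rapid.
- move=> _ k [g gs ->]; exists (fun x => c * partial k g x).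
    by exists (partial k g) => //; exact: schwartz_partial.
  by apply: is_partialZ; exact: schwartz_is_partial.
Qed.

Lemma oneDsqr_le_norm n (x : 'rV[R]_n) k : oneDsqr (x 0 k) <= (1 + `|x|) ^+ 2.
Proof.
have xk : `|x 0 k| <= `|x| by exact: coord_le_norm.
rewrite /oneDsqr -[x 0 k ^+ 2]real_normK ?num_real //.
have : 0 <= `|x 0 k| by []. nra.
Qed.

Lemma rapid_dominated n (h : 'rV[R]_n -> R[i]) : rapid h ->
  exists M, dominated M h.
Proof.
move=> hr; have [M hM] := hr (2 * n)%N; exists M => x.
rewrite /weight prodfV ler_pdivlMr; last first.
  by apply: prodr_gt0 => k _; rewrite (lt_le_trans ltr01) ?oneDsqr_ge1.
rewrite mulrC; apply: le_trans (hM x); rewrite ler_wpM2r ?modc_ge0 //.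
rewrite exprM -[X in _ ^+ X](card_ord n) -prodr_const.
apply: ler_prod => k _; rewrite oneDsqr_le_norm.
by rewrite (le_trans ler01) ?oneDsqr_ge1.
Qed.

Lemma rapid_slice n N (h : 'rV[R]_n.+1 -> R[i]) : rapid h ->
  exists M, forall u v, (1 + `|v|) ^+ N * modc (h (cons_rv u v)) <= M / oneDsqr u.
Proof.
move=> hr; have [M hM] := hr (N + 2)%N; exists M => u v.
rewrite ler_pdivlMr ?(lt_le_trans ltr01) ?oneDsqr_ge1 //.
apply: le_trans (hM (cons_rv u v)); rewrite mulrAC ler_wpM2r ?modc_ge0 //.
rewrite exprD; apply: ler_pM; first by rewrite exprn_ge0 ?addr_ge0.
- by rewrite (le_trans ler01) ?oneDsqr_ge1.
- rewrite lerXn2r ?nnegrE ?addr_ge0 // lerD2l; exact: norm_cons_rv_ge_tail.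
- by have := oneDsqr_le_norm (cons_rv u v) ord0; rewrite cons_rv0.
Qed.

Lemma rapid_slice_dominated1 n (h : 'rV[R]_n.+1 -> R[i]) : rapid h ->
  exists M, forall v, dominated1 M (fun u => h (cons_rv u v)).
Proof.
move=> /(rapid_slice 0) [M hM]; exists M => v u.
by have := hM u v; rewrite expr0 mul1r.
Qed.

End SchwartzSpace.

(** * Fourier inversion in several variables *)

Section FourierInversion.
Variable R : realType.

Lemma continuous_slice_head n (h : 'rV[R]_n.+1 -> R[i]) v :
  continuous (h : _ -> R[i]^o) ->
  continuous ((fun u => h (cons_rv u v)) : R -> R[i]^o).
Proof.
move=> hc; apply: continuous_compose hc.
by apply: continuous_cons_rv; [exact: continuous_idfun|exact: cst_continuous].
Qed.

Lemma continuous_expi_dotp n (a : 'rV[R]_n) :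
  continuous ((fun x => expi (dotp a x)) : 'rV[R]_n -> R[i]^o).
Proof.
by apply: continuous_expi; apply: continuous_dotp;
  [exact: cst_continuous|exact: continuous_idfun].
Qed.

Lemma dominated_expi n M (h : 'rV[R]_n -> R[i]) (a : 'rV[R]_n -> R) :
  dominated M h -> dominated M (fun x => expi (a x) * h x).
Proof. by move=> hM x; rewrite modcM modc_expi mul1r. Qed.

Lemma fourierZ n (h : 'rV[R]_n -> R[i]) c : schwartz h ->
  fourier (fun x => c * h x) = fun xi => c * fourier h xi.
Proof.
move=> hs; have [M hM] := rapid_dominated (schwartz_rapid hs).
apply/funext => xi; rewrite /fourier.
have hc := continuousMc (@continuous_expi_dotp n xi) (schwartz_continuous hs).
rewrite -(integral_rVZ c hc (dominated_expi (dotp xi) hM)).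
by congr integral_rV; apply/funext => x; rewrite mulrCA.
Qed.

Definition fourier_head n (xi0 : R) (psi : 'rV[R]_n.+1 -> R[i]) :
    'rV[R]_n -> R[i] :=
  fun v => fourier1 (fun u => psi (cons_rv u v)) xi0.

(** The derivative in another variable passes under the integral sign. *)
Lemma is_partial_fourier_head n (k : 'I_n) xi0 (psi : 'rV[R]_n.+1 -> R[i]) :
  schwartz psi -> is_partial k (fourier_head xi0 psi)
    (fourier_head xi0 (partial (lift ord0 k) psi)).
Proof.
move=> ps; have ds := schwartz_partial (lift ord0 k) ps.
have [M hM] := rapid_slice_dominated1 (schwartz_rapid ps).
have [M' hM'] := rapid_slice_dominated1 (schwartz_rapid ds).
pose g (phi : 'rV[R]_n.+1 -> R[i]) u v := expi (xi0 * u) * phi (cons_rv u v).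
have gd u : is_partial k (g psi u) (g (partial (lift ord0 k) psi) u).
  by apply: is_partialZ; apply: is_partial_slice_tail; exact: schwartz_is_partial.
have gc phi v : schwartz phi -> continuous ((fun u => g phi u v) : R -> R[i]^o).
  move=> phis; apply: (@continuous_expi_mul _ xi0 (fun u => phi (cons_rv u v))).
  exact/continuous_slice_head/schwartz_continuous.
have gM u v : modc (g psi u v) <= M / oneDsqr u.
  by rewrite modcM modc_expi mul1r; exact: hM.
have gM' u v : modc (g (partial (lift ord0 k) psi) u v) <= M' / oneDsqr u.
  by rewrite modcM modc_expi mul1r; exact: hM'.
move=> v; split.
- apply: (@is_derive_Rintegral_param _ n (fun u v => complex.Re (g psi u v))
    (fun u v => complex.Re (g (partial (lift ord0 k) psi) u v)) _ M M').
  + by move=> u w; have [] := gd u w.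
  + by move=> w; exact: (continuous_Re (gc psi w ps)).
  + by move=> u w; exact: le_trans (Re_le_modc _) (gM u w).
  + by move=> u w; exact: le_trans (Re_le_modc _) (gM' u w).
- apply: (@is_derive_Rintegral_param _ n (fun u v => complex.Im (g psi u v))
    (fun u v => complex.Im (g (partial (lift ord0 k) psi) u v)) _ M M').
  + by move=> u w; have [] := gd u w.
  + by move=> w; exact: (continuous_Im (gc psi w ps)).
  + by move=> u w; exact: le_trans (Im_le_modc _) (gM u w).
  + by move=> u w; exact: le_trans (Im_le_modc _) (gM' u w).
Qed.

Lemma schwartz_fourier_head n xi0 (psi : 'rV[R]_n.+1 -> R[i]) :
  schwartz psi -> schwartz (fourier_head xi0 psi).
Proof.
move=> ps; apply: (proj1 (schwartz_coinduction
  (A := fun g => exists2 h, schwartz h & g = fourier_head xi0 h) _ _ _ _)); last by exists psi.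
- move=> _ [h hs ->]; have [M hM] := rapid_slice_dominated1 (schwartz_rapid hs).
  apply: (@continuous_cintegral_param R 'rV[R]_n
    (fun p => expi (xi0 * p.2) * h (cons_rv p.2 p.1)) M).
    apply: continuousMc.
      apply: continuous_expi => p; apply: cvgM; first exact: cvg_cst.
      exact: continuous_pr2.
    apply: continuous_compose (schwartz_continuous hs).
    by apply: continuous_cons_rv; [exact: continuous_pr2|exact: continuous_pr1].
  by move=> v; apply: (dominated1_expi (fun u => xi0 * u)); exact: hM.
- move=> _ [h hs ->] N; have [M hM] := rapid_slice N (schwartz_rapid hs).
  exists (2 * pi * M) => v.
  have v0 : 0 < (1 + `|v|) ^+ N.
    by rewrite exprn_gt0 // (lt_le_trans ltr01) // one_norm_ge1.
  rewrite mulrC -ler_pdivlMr // -(mulrA (2 * pi)); apply: modc_cintegral_le.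
    apply: continuous_expi_mul.
    exact/continuous_slice_head/schwartz_continuous.
  apply: (dominated1_expi (fun u => xi0 * u)) => u.
  by rewrite mulrAC ler_pdivlMr // mulrC; exact: hM.
- move=> _ k [h hs ->]; exists (fourier_head xi0 (partial (lift ord0 k) h)).
    by exists (partial (lift ord0 k) h) => //; exact: schwartz_partial.
  exact: is_partial_fourier_head.
Qed.

Lemma fourier_cons n (psi : 'rV[R]_n.+1 -> R[i]) xi0 (xi : 'rV[R]_n) :
  schwartz psi -> fourier psi (cons_rv xi0 xi) = fourier (fourier_head xi0 psi) xi.
Proof.
move=> ps; have [M hM] := rapid_dominated (schwartz_rapid ps).
have pc := schwartz_continuous ps.
pose h (p : R * 'rV[R]_n) : R[i] :=
  expi (dotp xi p.2) * (expi (xi0 * p.1) * psi (cons_rv p.1 p.2)).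
transitivity (cintegral (fun u => integral_rV (fun v => h (u, v)))).
  congr cintegral; apply/funext => u; congr integral_rV; apply/funext => v.
  by rewrite [dotp _ _]dotp_cons expiD /h /= mulrA [_ * expi (xi0 * _)]mulrC.
rewrite (@cintegral_integral_rV_swap _ n M h).
- congr integral_rV; apply/funext => v; rewrite /h /fourier_head /fourier1 /=.
  have [M1 hM1] := rapid_slice_dominated1 (schwartz_rapid ps).
  apply: (cintegralZ (M := M1)).
    by apply: continuous_expi_mul; exact: continuous_slice_head.
  by apply: (dominated1_expi (fun u => xi0 * u)); exact: hM1.
- apply: continuousMc.
    exact: continuous_compose (@continuous_pr2 _ _) (@continuous_expi_dotp n xi).
  apply: continuousMc.
    apply: continuous_expi => p; apply: cvgM; first exact: cvg_cst.
    exact: continuous_pr1.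
  apply: continuous_compose pc.
  by apply: continuous_cons_rv; [exact: continuous_pr1|exact: continuous_pr2].
- move=> u v; rewrite /h !modcM !modc_expi !mul1r -mulrA -weight_cons.
  exact: hM.
Qed.

Lemma fourier_head_inversion n (psi : 'rV[R]_n.+1 -> R[i]) x0 v : schwartz psi ->
  fourier1 (fun xi0 => fourier_head xi0 psi v) x0 =
  (2 * pi)%:C * psi (cons_rv (- x0) v) /\
  exists M, continuous ((fun xi0 => fourier_head xi0 psi v) : R -> R[i]^o) /\
    dominated1 M (fun xi0 => fourier_head xi0 psi v).
Proof.
move=> ps; have ps1 := schwartz_partial ord0 ps.
have ps2 := schwartz_partial ord0 ps1.
have [M0 h0] := rapid_slice_dominated1 (schwartz_rapid ps).
have [M1 h1] := rapid_slice_dominated1 (schwartz_rapid ps1).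
have [M2 h2] := rapid_slice_dominated1 (schwartz_rapid ps2).
have c0 := @continuous_slice_head n psi v (schwartz_continuous ps).
have c2 := @continuous_slice_head n _ v (schwartz_continuous ps2).
have d0 := @is_partial_slice_head R n _ _ v (schwartz_is_partial ord0 ps).
have d1 := @is_partial_slice_head R n _ _ v (schwartz_is_partial ord0 ps1).
have FM := fourier1_dominated d0 d1 c2 (h0 v) (h1 v) (h2 v).
split; first exact: (fourier1_inversion x0 c0 (h0 v) FM).
exists (2 * pi * (M0 + M2)); split; last exact: FM.
exact: (continuous_fourier1 c0 (h0 v)).
Qed.

(** Let [H xi0] be the transform of [psi] in its first variable. As
[F psi (xi0, xi) = F (H xi0) xi], the induction hypothesis inverts the last [n]
variables and the one-variable formula inverts the first. The phase
[e^(i x0 xi0)] is moved into [H xi0] before the induction hypothesis is used: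
it is constant in [xi], and the product is again a Schwartz function. *)
Theorem fourier_inversion n (psi : 'rV[R]_n -> R[i]) : schwartz psi ->
  fourier (fourier psi) = fun x => ((2 * pi) ^+ n)%:C * psi (- x).
Proof.
elim: n psi => [|n IH] psi ps; apply/funext => x.
  rewrite /fourier /= /dotp !big_ord0 expi0 expr0 !mul1r.
  by congr psi; rewrite [RHS]thinmx0.
rewrite (cons_rv_eta x); set x0 := x 0 ord0; set x' := \row_k _.
have [inv [M [cH dH]]] := fourier_head_inversion x0 (- x') ps.
transitivity (cintegral (fun xi0 => ((2 * pi) ^+ n)%:C *
    (expi (x0 * xi0) * fourier_head xi0 psi (- x')))).
  congr cintegral; apply/funext => xi0.
  have hs : schwartz (fun v => expi (x0 * xi0) * fourier_head xi0 psi v).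
    by apply: schwartzZ; exact: schwartz_fourier_head.
  have /(congr1 (@^~ x')) <- := IH _ hs.
  congr integral_rV; apply/funext => xi.
  rewrite [dotp _ _]dotp_cons expiD [fourier psi _]fourier_cons //.
  by rewrite fourierZ; [rewrite mulrAC mulrC|exact: schwartz_fourier_head].
rewrite (cintegralZ (M := M)).
- by rewrite -[cintegral _]/(fourier1 (fun xi0 => fourier_head xi0 psi (- x')) x0)
    inv mulrA -rmorphM -exprSr -cons_rvN.
- exact: continuous_expi_mul.
- exact: (dominated1_expi (fun u => x0 * u)).
Qed.

End FourierInversion.

(** * Vanishing on the coordinate hyperplanes *)

Section PsiSpace.
Variable R : realType.

Lemma Psi_coinduction n (A : ('rV[R]_n -> R[i]) -> Prop) :
  (forall h, A h -> continuous (h : _ -> R[i]^o)) -> (forall h, A h -> rapid h) ->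
  (forall h k, A h -> exists2 h', A h' & is_partial k h h') ->
  (forall h (k : 'I_n) (x : 'rV[R]_n), A h -> x 0 k = 0 -> h x = 0) ->
  forall h, A h -> Psi_times h.
Proof.
move=> Ac Ar Ad Az h Ah; have [hs hA] := schwartz_coinduction Ac Ar Ad Ah.
by split=> // k s xi; exact: Az (hA s).
Qed.

Lemma Psi_partial n k (h : 'rV[R]_n -> R[i]) : Psi_times h -> Psi_times (partial k h).
Proof.
move=> [hs h0]; split=> [|j s xi xi0]; first exact: schwartz_partial.
by rewrite -partials_rcons; exact: h0 xi0.
Qed.

Lemma Psi_eq0 n (k : 'I_n) (h : 'rV[R]_n -> R[i]) (x : 'rV[R]_n) :
  Psi_times h -> x 0 k = 0 -> h x = 0.
Proof. by move=> [_ h0] x0; exact: (h0 k [::]). Qed.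

Lemma PsiZ n c (h : 'rV[R]_n -> R[i]) : Psi_times h -> Psi_times (fun x => c * h x).
Proof.
move=> hP.
apply: (@Psi_coinduction _ (fun g => exists2 h, Psi_times h & g = fun x => c * h x));
  last by exists h.
- move=> _ [g [gs _] ->]; apply: continuousMc; first exact: cst_continuous.
  exact: schwartz_continuous.
- by move=> _ [g [gs _] ->]; apply: rapidZ; exact: schwartz_rapid.
- move=> _ k [g gP ->]; exists (fun x => c * partial k g x).
    by exists (partial k g) => //; exact: Psi_partial.
  by apply: is_partialZ; apply: schwartz_is_partial; have [] := gP.
- by move=> _ k x [g gP ->] /(Psi_eq0 gP) ->; rewrite mulr0.
Qed.

(** The pointwise form of [is_partial] and [is_cderive]: products with a function
singular on a hyperplane are differentiated point by point. *)
Definition is_derivc (V : normedModType R) (x d : V) (f : V -> R[i]) (l : R[i]) :=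
  is_derive x d (@complex.Re R \o f) (complex.Re l) /\
  is_derive x d (@complex.Im R \o f) (complex.Im l).

Lemma is_derivc_transfer (V W : normedModType R) (f : V -> R[i]) (g : W -> R[i])
    (x d : V) (y e : W) l : (forall t : R, f (t *: d + x) = g (t *: e + y)) ->
  is_derivc y e g l -> is_derivc x d f l.
Proof.
by move=> fg [gr gi]; split; [apply: is_derive_transfer gr|apply: is_derive_transfer gi];
  move=> t /=; rewrite fg.
Qed.

Lemma is_derivc_cst (V : normedModType R) (x d : V) c : is_derivc x d (fun=> c) 0.
Proof. by split; exact: is_derive_cst. Qed.

Lemma is_derivcM (V : normedModType R) (x d : V) f g lf lg :
  is_derivc x d f lf -> is_derivc x d g lg ->
  is_derivc x d (fun y => f y * g y) (lf * g x + f x * lg).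
Proof.
move=> [fr fi] [gr gi]; split.
- rewrite (_ : _ \o _ = fun y => (@complex.Re R \o f) y * (@complex.Re R \o g) y
      - (@complex.Im R \o f) y * (@complex.Im R \o g) y); last first.
    by apply/funext => y /=; rewrite ReM.
  have h := is_deriveB (is_deriveM fr gr) (is_deriveM fi gi).
  by apply: (is_derive_eq h); rewrite ReD !ReM /GRing.scale /=; ring.
- rewrite (_ : _ \o _ = fun y => (@complex.Re R \o f) y * (@complex.Im R \o g) y
      + (@complex.Im R \o f) y * (@complex.Re R \o g) y); last first.
    by apply/funext => y /=; rewrite ImM.
  have h := is_deriveD (is_deriveM fr gi) (is_deriveM fi gr).
  by apply: (is_derive_eq h); rewrite ImD !ImM /GRing.scale /=; ring.
Qed.

Lemma is_derive_flat (V : normedModType R) (x d : V) (f : V -> R) M :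
  (forall t : R, `|f (t *: d + x)| <= M * t ^+ 2) -> is_derive x d f 0.
Proof.
move=> fM.
have f0 : f x = 0.
  apply/eqP; rewrite -normr_le0; have := fM 0.
  by rewrite scale0r add0r expr0n mulr0.
suff c : (fun h : R => h^-1 *: ((f \o shift x) (h *: d) - f x)) @ 0^' --> (0 : R).
  by split; [apply/cvg_ex; exists 0|exact: cvg_lim].
apply: norm_cvg0; apply: (@squeeze_cvgr _ _ _ _ (cst 0) (fun t => M * `|t|)).
- near=> t; have t0 : t != 0 by near: t; exact: nbhs_dnbhs_neq.
  rewrite normr_ge0 /= f0 subr0 normrM normfV.
  rewrite ler_pdivrMl ?normr_gt0 //; apply: le_trans (fM t) _.
  by rewrite -[t ^+ 2]real_normK ?num_real // expr2 mulrCA.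
- exact: cvg_cst.
- have h : `|t : R| @[t --> (0 : R)] --> (0 : R).
    by have := @norm_continuous _ R 0; rewrite /continuous_at normr0.
  rewrite -[X in _ --> X](mulr0 M); apply: cvgM; first exact: cvg_cst.
  exact: cvg_within_filter h.
Unshelve. all: by end_near. Qed.

Lemma is_derivc_flat (V : normedModType R) (x d : V) (f : V -> R[i]) M :
  (forall t : R, modc (f (t *: d + x)) <= M * t ^+ 2) -> is_derivc x d f 0.
Proof.
move=> fM; split; apply: (@is_derive_flat _ _ _ _ M) => t.
- exact: le_trans (Re_le_modc _) (fM t).
- exact: le_trans (Im_le_modc _) (fM t).
Qed.

Lemma mean_value_bound (g g' : R -> R) a K :
  (forall c : R, is_derive c (1 : R) g (g' c)) -> g 0 = 0 ->
  (forall c, `|c| <= `|a| -> `|g' c| <= K) -> `|g a| <= K * `|a|.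
Proof.
move=> gd g0 gK; have gc := is_derive_continuous gd.
have [a0|a0|<-] := ltgtP 0 a; last by rewrite g0 !normr0 mulr0.
- have [c] := @MVT R g g' 0 a a0 (fun x _ => gd x) (continuous_subspaceT gc).
  rewrite in_itv /= g0 !subr0 => /andP[c0 ca] ->.
  by rewrite normrM ler_wpM2r // gK // !gtr0_norm // ltW.
- have [c] := @MVT R g g' a 0 a0 (fun x _ => gd x) (continuous_subspaceT gc).
  rewrite in_itv /= g0 !sub0r => /andP[ac c0] /(congr1 Num.norm).
  rewrite normrN => ->; rewrite normrM normrN ler_wpM2r // gK //.
  by rewrite !ltr0_norm // lerN2 ltW.
Qed.

Definition flat n (k : 'I_n) (h : 'rV[R]_n -> R[i]) := forall N p, exists2 M,
  0 <= M & forall x, (1 + `|x|) ^+ N * modc (h x) <= M * `|x 0 k| ^+ p.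

Lemma rapidP n (h : 'rV[R]_n -> R[i]) : rapid h -> forall N, exists2 M,
  0 <= M & forall x, (1 + `|x|) ^+ N * modc (h x) <= M.
Proof.
move=> hr N; have [M hM] := hr N; exists M => //.
by apply: le_trans (hM 0); rewrite mulr_ge0 ?modc_ge0 ?exprn_ge0 ?addr_ge0.
Qed.

(** Vanishing to infinite order on the hyperplane, with the weights of the
Schwartz norms: the mean value theorem in the direction [k] gains a factor
[|x_k|], and the segment from [x] to the hyperplane stays at bounded distance
from [x] when [|x_k| <= 1], so the weights are comparable along it. *)
Lemma Psi_flat n k (chi : 'rV[R]_n -> R[i]) : Psi_times chi -> flat k chi.
Proof.
move=> cP N p; elim: p chi cP => [|p IH] chi cP; have [cs _] := cP.
  have [M M0 cM] := rapidP (schwartz_rapid cs) N.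
  by exists M => // x; rewrite expr0 mulr1.
have [M M0 dM] := IH _ (Psi_partial k cP).
have [M2 M20 cM2] := rapidP (schwartz_rapid cs) N.
exists (2 * (3 ^+ N * M) + M2) => [|x].
  by rewrite addr_ge0 // mulr_ge0 // mulr_ge0 // exprn_ge0.
have [x1|x1] := lerP `|x 0 k| 1; last first.
  apply: le_trans (cM2 x) _; apply: (@le_trans _ _ (M2 * `|x 0 k| ^+ p.+1)).
    by rewrite ler_peMr // exprn_ege1 // ltW.
  by rewrite ler_wpM2r ?exprn_ge0 // lerDr mulr_ge0 // mulr_ge0 // exprn_ge0.
pose x0 := - x 0 k *: delta_mx 0 k + x.
have xE c : (c *: delta_mx 0 k + x0) 0 k = c.
  by rewrite line_coord delta_coord eqxx mulr1 line_coord delta_coord eqxx mulr1 addNr addr0.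
have x0E : x 0 k *: delta_mx 0 k + x0 = x by rewrite /x0 scaleNr addrA subrr add0r.
have W0 : 0 < (1 + `|x|) ^+ N by rewrite exprn_gt0 // (lt_le_trans ltr01) // one_norm_ge1.
have dK c : `|c| <= `|x 0 k| ->
    modc (partial k chi (c *: delta_mx 0 k + x0)) <=
    3 ^+ N * M * `|x 0 k| ^+ p / (1 + `|x|) ^+ N.
  move=> ck; set y := _ + x0; rewrite ler_pdivlMr // mulrC.
  (* [|x - y| <= 2] as both [|c|] and [|x_k|] are at most 1 *)
  have xy : 1 + `|x| <= 3 * (1 + `|y|).
    have : `|x - y| <= 2.
      rewrite -x0E /y opprD addrACA subrr addr0 -scalerBl.
      apply: norm_rV_le => // j; rewrite mxE delta_coord.
      case: (j == k); last by rewrite mulr0 normr0.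
      rewrite mulr1 (le_trans (ler_normB _ _)) // (_ : 2 = 1 + 1) //.
      by rewrite lerD // (le_trans ck).
    have := ler_normD (x - y) y; rewrite subrK.
    have : 0 <= `|y| by []. lra.
  apply: (@le_trans _ _ (3 ^+ N * ((1 + `|y|) ^+ N * modc (partial k chi y)))).
    by rewrite mulrA -exprMn ler_wpM2r ?modc_ge0 // lerXn2r ?nnegrE.
  rewrite -mulrA ler_wpM2l ?exprn_ge0 //; apply: le_trans (dM y) _.
  by rewrite ler_wpM2l // lerXn2r ?nnegrE // /y xE.
have line (g : R[i] -> R) : g = @complex.Re R \/ g = @complex.Im R -> 
    `|g (chi x)| <= 3 ^+ N * M * `|x 0 k| ^+ p / (1 + `|x|) ^+ N * `|x 0 k|.
  move=> gE; rewrite -[in leLHS]x0E.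
  apply: (@mean_value_bound (fun s => g (chi (s *: delta_mx 0 k + x0)))
    (fun c => g (partial k chi (c *: delta_mx 0 k + x0)))).
  - move=> c; have [dr di] := schwartz_is_partial k cs (c *: delta_mx 0 k + x0).
    have [hr hi] : is_derivc (c : R^o) (1 : R^o) (fun s : R => chi (s *: delta_mx 0 k + x0))
        (partial k chi (c *: delta_mx 0 k + x0)).
      apply: is_derivc_transfer (conj dr di) => t.
      have -> : t%:A = t :> R^o by exact: mulr1.
      by rewrite scalerDl -addrA.
    by case: gE => ->.
  - have -> : chi (0 *: delta_mx 0 k + x0) = 0 by apply: (Psi_eq0 (k := k) cP); rewrite xE.
    by case: gE => ->.
  - move=> c ck; apply: le_trans (dK c ck).
    by case: gE => ->; [exact: Re_le_modc|exact: Im_le_modc].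
have b : modc (chi x) <= 2 * (3 ^+ N * M * `|x 0 k| ^+ p / (1 + `|x|) ^+ N * `|x 0 k|).
  apply: le_trans (modc_le_ReIm _) _; rewrite mulr_natl mulr2n.
  by rewrite lerD // line //; [left|right].
apply: (@le_trans _ _ (2 * (3 ^+ N * M) * `|x 0 k| ^+ p.+1)).
  rewrite mulrC -ler_pdivlMr //; apply: le_trans b _.
  by rewrite exprS le_eqVlt; apply/orP; left; apply/eqP; ring.
by rewrite ler_wpM2r ?exprn_ge0 // lerDl.
Qed.

Lemma flat_eq0 n (k : 'I_n) h (x : 'rV[R]_n) : flat k h -> x 0 k = 0 -> h x = 0.
Proof.
move=> /(_ 0%N 1%N)[M _ hM] x0; have := hM x.
rewrite x0 normr0 expr0n mulr0 expr0 mul1r => h0.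
apply: ComplexField.Normc.eq0_normc; apply/eqP.
by rewrite eq_le h0 modc_ge0.
Qed.

Lemma flat_rapid n (k : 'I_n) h : flat k h -> rapid h.
Proof.
by move=> hf N; have [M _ hM] := hf N 0%N; exists M => x; have := hM x; rewrite expr0 mulr1.
Qed.

End PsiSpace.

(** * Multiplication by complex powers of the coordinates *)

Section SingularMultiplier.
Variable R : realType.
Implicit Types (b : R[i]).

(** The powers [t^(- m) |t|^b]. With [b] fixed, differentiation multiplies by a
scalar and raises [m], on both half-lines and without a sign function. The value
at 0 is irrelevant: these powers multiply functions that vanish there. *)
Definition sing b m (t : R) : R[i] := ((t^-1) ^+ m)%:C * cpow `|t| b.

Lemma singS b m t : sing b m.+1 t = (t^-1)%:C * sing b m t.
Proof. by rewrite /sing exprS mulrA -rmorphM. Qed.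

Lemma is_derivc_cpow b (t : R) : t != 0 ->
  is_derivc (t : R^o) (1 : R^o) (fun t : R => cpow `|t| b) (b * sing b 1 t).
Proof.
move=> t0.
(* true at [s = 0] as well, where both logarithms are 0; the right-hand side is
differentiated by the chain rule on both half-lines at once *)
have lnE (s : R) : ln `|s| = ln (s ^+ 2) / 2.
  have [->|s0] := eqVneq s 0; first by rewrite normr0 expr0n ln0 // mul0r.
  rewrite -[s ^+ 2]real_normK ?num_real // lnXn ?normr_gt0 //.
  by rewrite mulr2n; field.
have dln : is_derive (t : R^o) (1 : R^o) (fun s : R => ln `|s|) t^-1.
  rewrite (_ : (fun s => _) = fun s : R => ln (s ^+ 2) / 2); last exact/funext.
  have t2 : 0 < t ^+ 2 by rewrite exprn_even_gt0.
  have d1 := is_derive1_ln t2.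
  have d2 : is_derive (t : R^o) (1 : R^o) (fun s : R => s ^+ 2) (2 * t).
    by apply: is_derive_eq; rewrite /GRing.scale /= mulr1 mulr_natl.
  have d3 := @is_derive1_comp R (@ln R) (fun s => s ^+ 2) t _ _ d1 d2.
  have := is_deriveZ (2^-1 : R) d3.
  rewrite (_ : _ \*: _ = fun s : R => ln (s ^+ 2) / 2); last first.
    by apply/funext => s /=; rewrite mulrC.
  move=> h; apply: (is_derive_eq h); rewrite /GRing.scale /=.
  by field.
have sE : sing b 1 t = (t^-1)%:C * cpow `|t| b by rewrite /sing expr1.
split.
- rewrite (_ : _ \o _ = fun s : R => expR (complex.Re b * ln `|s|) *
      cos (complex.Im b * ln `|s|)); last first.
    by apply/funext => s; rewrite -[LHS]/(complex.Re (cpow `|s| b)) /cpow Re_realM.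
  apply: is_derive_eq; rewrite sE /cpow !ReM !ImM /GRing.scale /=; ring.
- rewrite (_ : _ \o _ = fun s : R => expR (complex.Re b * ln `|s|) *
      sin (complex.Im b * ln `|s|)); last first.
    by apply/funext => s; rewrite -[LHS]/(complex.Im (cpow `|s| b)) /cpow Im_realM.
  apply: is_derive_eq; rewrite sE /cpow !ImM !ReM /GRing.scale /=; ring.
Qed.

Lemma is_derivc_sing b m (t : R) : t != 0 ->
  is_derivc (t : R^o) (1 : R^o) (sing b m) ((b - m%:R) * sing b m.+1 t).
Proof.
move=> t0; elim: m => [|m IH].
  have -> : sing b 0 = fun t : R => cpow `|t| b.
    by apply/funext => s; rewrite /sing expr0 mul1r.
  by rewrite subr0; exact: is_derivc_cpow.
have -> : sing b m.+1 = fun s => (s^-1)%:C * sing b m s.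
  by apply/funext => s; exact: singS.
have dV : is_derivc (t : R^o) (1 : R^o) (fun s : R => (s^-1)%:C) (- t ^- 2)%:C.
  split; last exact: (is_derive_cst (0 : R) (t : R^o) (1 : R^o)).
  have := @is_deriveV R id t 1 1 t0 (is_derive_id _ _).
  by rewrite /GRing.scale /= mulr1.
have := is_derivcM dV IH; rewrite !singS.
suff -> : (- t ^- 2)%:C * sing b m t + (t^-1)%:C * ((b - m%:R) * ((t^-1)%:C * sing b m t)) =
  (b - m.+1%:R) * ((t^-1)%:C * ((t^-1)%:C * sing b m t)) by [].
rewrite rmorphN /= -exprVn rmorphXn /= -natr1; ring.
Qed.

Lemma continuous_at_derivc (f : R -> R[i]) (t : R) l :
  is_derivc (t : R^o) (1 : R^o) f l -> {for t, continuous (f : R -> R[i]^o)}.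
Proof.
move=> [[fr _] [fi _]]; apply: cvg_complex.
- by apply: (@differentiable_continuous _ _ _ t (@complex.Re R \o f)); apply/derivable1_diffP.
- by apply: (@differentiable_continuous _ _ _ t (@complex.Im R \o f)); apply/derivable1_diffP.
Qed.

Lemma modc_cpow (x : R) b : modc (cpow x b) = expR (complex.Re b * ln x).
Proof. by rewrite modcM modc_expi mulr1 modcR ger0_norm ?expR_ge0. Qed.

(** An exponent [q >= m + |Re b|] serves both near 0 and near infinity. *)
Lemma modc_sing_le b m : exists q, forall t : R,
  (0 < `|t| <= 1 -> modc (sing b m t) <= `|t| ^- q) /\
  (1 <= `|t| -> modc (sing b m t) <= `|t| ^+ q).
Proof.
(* a natural bound of the real part of the exponent, of either sign *)
pose B := Num.bound `|complex.Re b|.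
have bB : `|complex.Re b| <= B%:R.
  by apply: ltW; rewrite archi_boundP.
exists (m + B)%N => t; rewrite /sing modcM modcR normrX normfV modc_cpow.
have expX (x : R) : 0 < x -> x ^+ B = expR (B%:R * ln x).
  by move=> x0; rewrite mulrC expRM_natr lnK.
split=> [/andP[t0 t1]|t1].
- rewrite exprD invfM -exprVn ler_wpM2l ?exprn_ge0 ?invr_ge0 //.
  rewrite expX // -expRN ler_expR -mulNr ler_wnM2r //.
    exact: ln_le0.
  by rewrite lerNl; apply: le_trans bB; rewrite -normrN ler_norm.
- have t0 : 0 < `|t| by exact: lt_le_trans t1.
  rewrite exprD ler_pM ?exprn_ge0 ?invr_ge0 ?expR_ge0 //.
    apply: (@le_trans _ _ 1); last exact: exprn_ege1.
    by rewrite exprn_ile1 ?invr_ge0 // invf_le1.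
  rewrite expX // ler_expR ler_wpM2r ?ln_ge0 //.
  exact: le_trans (ler_norm _) bB.
Qed.

(** Near the hyperplane, vanishing to order [q + p] absorbs a pole of order [q] and
leaves [|x_k|^p]; away from it, rapid decrease absorbs a growth of order [q]. *)
Lemma flat_sing n (k : 'I_n) b m (h : 'rV[R]_n -> R[i]) : flat k h ->
  flat k (fun x => sing b m (x 0 k) * h x).
Proof.
move=> hf N p; have [q sq] := modc_sing_le b m.
have [M1 M10 h1] := hf N (q + p)%N; have [M2 M20 h2] := hf (N + q)%N 0%N.
exists (M1 + M2) => [|x]; first exact: addr_ge0.
have [x0|x0] := eqVneq (x 0 k) 0.
  rewrite (flat_eq0 hf x0) mulr0 modc0 mulr0.
  by rewrite mulr_ge0 ?addr_ge0 ?exprn_ge0.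
have ax : 0 < `|x 0 k| by rewrite normr_gt0.
have [s1 s2] := sq (x 0 k); rewrite modcM mulrCA.
have W0 : 0 <= (1 + `|x|) ^+ N by rewrite exprn_ge0 // addr_ge0.
have [x1|x1] := lerP `|x 0 k| 1.
- apply: (@le_trans _ _ (M1 * `|x 0 k| ^+ p)); last first.
    by rewrite ler_wpM2r ?exprn_ge0 // lerDl.
  apply: (@le_trans _ _ (`|x 0 k| ^- q * (M1 * `|x 0 k| ^+ (q + p)))).
    apply: ler_pM; rewrite ?modc_ge0 ?mulr_ge0 ?modc_ge0 //.
    by apply: s1; rewrite ax.
  rewrite mulrCA exprD mulKf // expf_neq0 //; exact: lt0r_neq0.
- apply: (@le_trans _ _ (M2 * `|x 0 k| ^+ p)); last first.
    by rewrite ler_wpM2r ?exprn_ge0 // lerDr.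
  apply: (@le_trans _ _ M2); last by rewrite ler_peMr // exprn_ege1 // ltW.
  have := h2 x; rewrite expr0 mulr1; apply: le_trans.
  rewrite exprD -mulrA mulrCA ler_wpM2l // ler_wpM2r ?modc_ge0 //.
  apply: (le_trans (s2 (ltW x1))); rewrite lerXn2r ?nnegrE ?addr_ge0 //.
  by apply: (le_trans (coord_le_norm x k)); rewrite lerDr.
Qed.

Lemma continuous_flat n (k : 'I_n) (h : 'rV[R]_n -> R[i]) (x : 'rV[R]_n) : flat k h ->
  x 0 k = 0 -> {for x, continuous (h : _ -> R[i]^o)}.
Proof.
move=> hf x0; have [M M0 hM] := hf 0%N 1%N.
have hx : h x = 0 by exact: flat_eq0 x0.
have bnd (g : 'rV[R]_n -> R) : (forall y, `|g y| <= modc (h y)) ->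
    g y @[y --> x] --> (0 : R).
  move=> gh.
  have c : continuous (fun y : 'rV[R]_n => M * `|y 0 k|).
    apply: (continuous_compose (g := fun s : R => M * `|s|) (@continuous_coord R n k)).
    by move=> s; apply: cvgM; [exact: cvg_cst|exact: norm_continuous].
  have := c x; rewrite /continuous_at x0 normr0 mulr0.
  move=> /(cvgrPdist_lt (FF := nbhs_filter x)) cx.
  apply/(cvgrPdist_lt (FF := nbhs_filter x)) => e e0; near=> y; rewrite sub0r normrN.
  apply: le_lt_trans (gh y) _; apply: (@le_lt_trans _ _ (M * `|y 0 k|)).
    by have := hM y; rewrite expr0 mul1r expr1.
  have : `|0 - M * `|y 0 k| | < e by near: y; exact: cx.
  by rewrite sub0r normrN; apply: le_lt_trans; exact: ler_norm.
rewrite /prop_for /continuous_at hx.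
apply: (cvg_complex (FF := nbhs_filter x)).
- by apply: (bnd (fun y => complex.Re (h y))) => y; exact: Re_le_modc.
- by apply: (bnd (fun y => complex.Im (h y))) => y; exact: Im_le_modc.
Unshelve. all: by end_near. Qed.

Lemma coord_line_neq n (j k : 'I_n) (t : R) (x : 'rV[R]_n) : k != j ->
  (t *: delta_mx 0 j + x) 0 k = x 0 k.
Proof. by move=> kj; rewrite line_coord delta_coord (negbTE kj) mulr0 add0r. Qed.

Lemma coord_line_eq n (k : 'I_n) (t : R) (x : 'rV[R]_n) :
  (t *: delta_mx 0 k + x) 0 k = t + x 0 k.
Proof. by rewrite line_coord delta_coord eqxx mulr1. Qed.

(** On the hyperplane [x_k = 0] every term vanishes: in the direction [k] the
difference quotients tend to 0 by flatness, and the other directions stay in the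
hyperplane. *)
Lemma is_partial_sing n (k j : 'I_n) b m (chi : 'rV[R]_n -> R[i]) :
  Psi_times chi ->
  is_partial j (fun x => sing b m (x 0 k) * chi x)
    (fun x => sing b m (x 0 k) * partial j chi x +
      sing b m.+1 (x 0 k) * ((if k == j then b - m%:R else 0) * chi x)).
Proof.
move=> cP x; have [cs _] := cP.
have [x0|x0] := eqVneq (x 0 k) 0.
  rewrite (Psi_eq0 cP x0) (Psi_eq0 (Psi_partial j cP) x0) !mulr0 addr0.
  have hf := flat_sing b m (Psi_flat k cP).
  have [kj|kj] := eqVneq k j.
    have [M M0 hM] := hf 0%N 2%N; rewrite -kj.
    apply: (@is_derivc_flat _ _ _ _ _ M) => t.
    have := hM (t *: delta_mx 0 k + x); rewrite expr0 mul1r => /le_trans; apply.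
    by rewrite coord_line_eq x0 addr0 real_normK ?num_real.
  apply: is_derivc_transfer (is_derivc_cst (0 : R^o) (1 : R^o) 0) => t.
  by rewrite (Psi_eq0 (k := k) cP) ?mulr0 // coord_line_neq.
have dchi : is_derivc x (delta_mx 0 j) chi (partial j chi x).
  by have := schwartz_is_partial j cs x.
have dsing : is_derivc x (delta_mx 0 j) (fun y : 'rV[R]_n => sing b m (y 0 k))
    ((if k == j then b - m%:R else 0) * sing b m.+1 (x 0 k)).
  have [kj|kj] := eqVneq k j.
    rewrite -kj; apply: is_derivc_transfer (is_derivc_sing b m x0) => t.
    by rewrite coord_line_eq /GRing.scale /= mulr1.
  rewrite mul0r.
  apply: is_derivc_transfer (is_derivc_cst (0 : R^o) (1 : R^o) (sing b m (x 0 k))) => t.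
  by rewrite coord_line_neq.
move: dsing; set c := if k == j then _ else _ => dsing.
have e : sing b m (x 0 k) * partial j chi x + sing b m.+1 (x 0 k) * (c * chi x) =
    c * sing b m.+1 (x 0 k) * chi x + sing b m (x 0 k) * partial j chi x by ring.
by rewrite e; exact: is_derivcM dsing dchi.
Qed.

(** The functions [t^(-m) |t|^b] of [t = x_k], [m] a natural number, are stable
under the derivative up to scalars, which makes this span stable under the
partial derivatives. *)
Inductive sing_span n (k : 'I_n) b : ('rV[R]_n -> R[i]) -> Prop :=
| SingTerm m chi : Psi_times chi ->
    sing_span k b (fun x => sing b m (x 0 k) * chi x)
| SingAdd f g : sing_span k b f -> sing_span k b g ->
    sing_span k b (fun x => f x + g x).

Lemma rapidD n (f g : 'rV[R]_n -> R[i]) : rapid f -> rapid g ->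
  rapid (fun x => f x + g x).
Proof.
move=> fr gr N; have [M fM] := fr N; have [M' gM] := gr N.
exists (M + M') => x; apply: le_trans (lerD (fM x) (gM x)).
by rewrite -mulrDr ler_wpM2l ?modcD // exprn_ge0 // addr_ge0.
Qed.

Lemma Psi_sing_span n (k : 'I_n) b h : sing_span k b h -> Psi_times h.
Proof.
apply: Psi_coinduction.
- move=> h'; elim=> {h'} [m chi cP|f g _ fc _ gc]; last exact: (continuousDc fc gc).
  move=> x; have [x0|x0] := eqVneq (x 0 k) 0.
    exact: (continuous_flat (flat_sing b m (Psi_flat k cP)) x0).
  have [cs _] := cP.
  apply: (@continuous_atMc R _ (fun x : 'rV[R]_n => sing b m (x 0 k)) chi x).
    apply: (@continuous_at_compose _ _ R[i]^o _ (sing b m) x (@continuous_coord R n k)).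
    exact: (continuous_at_derivc (is_derivc_sing b m x0)).
  exact: schwartz_continuous.
- move=> h'; elim=> {h'} [m chi cP|f g _ fr _ gr]; last exact: rapidD.
  exact: flat_rapid (flat_sing b m (Psi_flat k cP)).
- move=> h' j; elim=> {h'} [m chi cP|f g _ [f' fs' fd] _ [g' gs' gd]]; last first.
    by exists (fun x => f' x + g' x); [exact: SingAdd|exact: is_partialD].
  eexists; last exact: is_partial_sing.
  apply: SingAdd; apply: SingTerm; first exact: Psi_partial.
  exact: PsiZ.
- move=> h' j x; elim=> {h'} [m chi cP|f g _ fz _ gz] x0; first by rewrite (Psi_eq0 cP x0) mulr0.
  by rewrite fz // gz // addr0.
Qed.

Lemma Psi_cpow n (k : 'I_n) b (psi : 'rV[R]_n -> R[i]) : Psi_times psi ->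
  Psi_times (fun x => cpow `|x 0 k| b * psi x).
Proof.
move=> pP; have := Psi_sing_span (SingTerm k b 0 pP).
by congr (Psi_times _); apply/funext => x; rewrite /sing expr0 mul1r.
Qed.

Definition multiplier n (beta : 'rV[R[i]]_n) (x : 'rV[R]_n) : R[i] :=
  \prod_(k < n) cpow `|x 0 k| (beta 0 k).

Lemma Psi_multiplier n (beta : 'rV[R[i]]_n) (psi : 'rV[R]_n -> R[i]) :
  Psi_times psi -> Psi_times (fun x => multiplier beta x * psi x).
Proof.
move=> pP; rewrite /multiplier; elim: (index_enum _) => [|k r IH].
  by move: pP; congr Psi_times; apply/funext => x; rewrite big_nil mul1r.
have := Psi_cpow k (beta 0 k) IH; congr Psi_times; apply/funext => x.
by rewrite big_cons mulrA.
Qed.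

End SingularMultiplier.

(** * The multi-Riesz operator on test functions and functionals *)

Section RieszOnLizorkin.
Variable R : realType.
Implicit Types (b : R[i]).

Lemma is_partial_scale n (k : 'I_n) c (f f' : 'rV[R]_n -> R[i]) :
  is_partial k f f' ->
  is_partial k (fun x => f (c *: x)) (fun x => c%:C * f' (c *: x)).
Proof.
move=> fd x; have [fr fi] := fd (c *: x).
have chain (g : 'rV[R]_n -> R) l : is_derive (c *: x) (delta_mx 0 k) g l ->
    is_derive x (delta_mx 0 k) (fun y : 'rV[R]_n => g (c *: y)) (c * l).
  move=> gd; pose h (s : R) := g (s *: delta_mx 0 k + c *: x).
  have hd : is_derive (c * 0 : R^o) (1 : R^o) h l.
    rewrite mulr0; apply: is_derive_transfer gd => t.
    by rewrite addr0 /h -[t *: 1]/(t * 1) mulr1.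
  have cd : is_derive (0 : R^o) (1 : R^o) (fun s : R => c * s) c.
    by apply: is_derive_eq; rewrite /GRing.scale /= ?mulr0 ?add0r ?addr0 mulr1.
  have := is_derive1_comp hd cd; rewrite mulrC.
  apply: is_derive_transfer => t.
  by rewrite /= /h addr0 -[t *: 1]/(t * 1) mulr1 scalerDr scalerA.
split.
- by rewrite Re_realM; exact: chain fr.
- by rewrite Im_realM; exact: chain fi.
Qed.

Lemma rapid_scale n c (h : 'rV[R]_n -> R[i]) : c != 0 -> rapid h ->
  rapid (fun x => h (c *: x)).
Proof.
move=> c0 hr N; have [M hM] := hr N.
exists ((1 + `|c|^-1) ^+ N * M) => x.
have c1 : 0 <= 1 + `|c|^-1 by rewrite addr_ge0 ?invr_ge0.
apply: (@le_trans _ _ ((1 + `|c|^-1) ^+ N * ((1 + `|c *: x|) ^+ N * modc (h (c *: x))))).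
  rewrite mulrA -exprMn ler_wpM2r ?modc_ge0 // lerXn2r ?nnegrE ?addr_ge0 //.
  rewrite normrZ mulrDl mul1r mulrDr mulr1 mulKf ?normr_eq0 //.
  have : 0 <= `|c| * `|x| by rewrite mulr_ge0.
  have : 0 <= `|c|^-1 by rewrite invr_ge0.
  lra.
by rewrite ler_wpM2l // exprn_ge0.
Qed.

Lemma Psi_scale n c (psi : 'rV[R]_n -> R[i]) : c != 0 -> Psi_times psi ->
  Psi_times (fun x => psi (c *: x)).
Proof.
move=> c0 pP.
apply: (@Psi_coinduction _ _
  (fun g => exists2 h, Psi_times h & g = fun x => h (c *: x))); last by exists psi.
- move=> _ [g [gs _] ->]; apply: continuous_compose (schwartz_continuous gs).
  apply: continuous_rV => k.
  rewrite (_ : (fun x : 'rV[R]_n => (c *: x) 0 k) = fun x : 'rV[R]_n => c * x 0 k);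
    last by apply/funext => x; rewrite mxE.
  apply: (continuous_compose (g := fun s => c * s) (@continuous_coord R n k)).
  by move=> s; apply: cvgM; [exact: cvg_cst|exact: cvg_id].
- by move=> _ [g [gs _] ->]; apply: rapid_scale => //; exact: schwartz_rapid.
- move=> _ k [g gP ->]; exists (fun x => c%:C * partial k g (c *: x)).
    exists (fun x => c%:C * partial k g x) => //; apply: PsiZ; exact: Psi_partial.
  by apply: is_partial_scale; apply: schwartz_is_partial; have [] := gP.
- move=> _ k x [g gP ->] x0; apply: (Psi_eq0 (k := k) gP).
  by rewrite mxE x0 mulr0.
Qed.

Lemma cpowD (t : R) a b : cpow t (a + b) = cpow t a * cpow t b.
Proof.
rewrite /cpow ReD ImD !mulrDl expRD expiD rmorphM /=; ring.
Qed.

Lemma cpow0 (t : R) : cpow t 0 = 1.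
Proof. by rewrite /cpow !mul0r expR0 expi0 mulr1. Qed.

Lemma cpowM (s t : R) b : 0 < s -> 0 < t -> cpow (s * t) b = cpow s b * cpow t b.
Proof.
move=> s0 t0; rewrite /cpow lnM // !mulrDr expRD expiD rmorphM /=; ring.
Qed.

Lemma cpow_neq0 (t : R) b : cpow t b != 0.
Proof.
apply/eqP => /(congr1 (@ComplexField.Normc.normc R)); rewrite modc_cpow modc0.
by apply/eqP; rewrite gt_eqF ?expR_gt0.
Qed.

Lemma cpow_sum (t : R) n (F : 'I_n -> R[i]) :
  \prod_(k < n) cpow t (F k) = cpow t (\sum_(k < n) F k).
Proof.
elim/big_rec2: _ => [|k y1 y2 _ ->]; first by rewrite cpow0.
by rewrite cpowD.
Qed.

Lemma multiplierN n (beta : 'rV[R[i]]_n) (x : 'rV[R]_n) :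
  multiplier beta (- x) = multiplier beta x.
Proof. by apply: eq_bigr => k _; rewrite mxE normrN. Qed.

(** This holds on the hyperplanes too, the value of [cpow] at 0 being 1. *)
Lemma multiplier_opp n (beta : 'rV[R[i]]_n) (x : 'rV[R]_n) :
  multiplier beta x * multiplier (- beta) x = 1.
Proof.
rewrite /multiplier -big_split /= big1 // => k _.
by rewrite mxE -cpowD subrr cpow0.
Qed.

(** Homogeneity of the multiplier; on the coordinate hyperplanes it is rescued by
the vanishing of [psi]. *)
Lemma multiplier_scale n (beta : 'rV[R[i]]_n) (psi : 'rV[R]_n -> R[i]) (t : R) x :
  0 < t -> Psi_times psi ->
  multiplier beta x * psi (t *: x) =
  cpow t (\sum_(k < n) - beta 0 k) * (multiplier beta (t *: x) * psi (t *: x)).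
Proof.
move=> t0 pP.
have [/existsP[k /eqP xk]|] := boolP [exists k, x 0 k == 0].
  by rewrite (Psi_eq0 (k := k) pP) ?mulr0 // mxE xk mulr0.
rewrite negb_exists => /forallP x0; rewrite mulrA; congr (_ * _).
have -> : multiplier beta (t *: x) =
    cpow t (\sum_(k < n) beta 0 k) * multiplier beta x.
  rewrite -cpow_sum /multiplier -big_split /=; apply: eq_bigr => k _.
  by rewrite mxE normrM (gtr0_norm t0) cpowM ?normr_gt0.
by rewrite mulrA -cpowD sumrN addNr cpow0 mul1r.
Qed.

Lemma dotpC n (x y : 'rV[R]_n) : dotp x y = dotp y x.
Proof. by apply: eq_bigr => k _; rewrite mulrC. Qed.

Lemma dotpN n (x y : 'rV[R]_n) : dotp x (- y) = - dotp x y.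
Proof. by rewrite /dotp -sumrN; apply: eq_bigr => k _; rewrite mxE mulrN. Qed.

Lemma dotpZl n c (x y : 'rV[R]_n) : dotp (c *: x) y = c * dotp x y.
Proof. by rewrite /dotp mulr_sumr; apply: eq_bigr => k _; rewrite mxE mulrA. Qed.

Lemma dotpZr n c (x y : 'rV[R]_n) : dotp x (c *: y) = c * dotp x y.
Proof. by rewrite /dotp mulr_sumr; apply: eq_bigr => k _; rewrite mxE mulrCA. Qed.

(** By inversion, the transform of [F psi] is a reflection of [psi] up to a
factor, which the inverse transform undoes as the multiplier is even. *)
Lemma multi_riesz_fourier n (beta : 'rV[R[i]]_n) (psi : 'rV[R]_n -> R[i]) :
  Psi_times psi ->
  multi_riesz beta (fourier psi) = fourier (fun x => multiplier beta x * psi x).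
Proof.
move=> pP; have [ps _] := pP; have [ms _] := Psi_multiplier beta pP.
apply/funext => x; rewrite /multi_riesz fourier_inversion // /inv_fourier.
set h := fun x => multiplier beta x * psi x.
have [M hM] := rapid_dominated (schwartz_rapid ms).
have kc := continuousMc (@continuous_expi_dotp R n x) (schwartz_continuous ms).
have kM := dominated_expi (dotp x) hM.
pose c : R[i] := ((2 * pi) ^+ n)%:C.
pose k xi := expi (dotp x xi) * h xi.
transitivity (((2 * pi) ^- n)%:C * (c * integral_rV (fun xi => k (- xi)))); last first.
  rewrite (integral_rV_opp kc kM) mulrA -rmorphM mulVf ?mul1r //.
  by rewrite expf_neq0 // mulf_neq0 ?pnatr_eq0 // gt_eqF ?pi_gt0.
congr (_ * _); rewrite (integral_rV_opp kc kM) -(integral_rVZ c kc kM).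
rewrite -[RHS](integral_rV_opp (M := modc c * M)).
- congr integral_rV; apply/funext => xi; rewrite /k /h dotpN multiplierN.
  by rewrite -/(multiplier beta xi) (dotpC xi) [multiplier _ _ * (_ * _)]mulrCA [LHS]mulrCA.
- exact: (continuousMc (@cst_continuous _ _ _) kc).
- by move=> y; rewrite modcM -mulrA ler_wpM2l ?modc_ge0.
Qed.

Lemma fourier_scale n (psi : 'rV[R]_n -> R[i]) (t : R) : 0 < t -> schwartz psi ->
  (fun x => fourier psi (t^-1 *: x)) =
  (fun x => (t ^+ n)%:C * fourier (fun y => psi (t *: y)) x).
Proof.
move=> t0 ps; apply/funext => x.
have [M hM] := rapid_dominated (schwartz_rapid ps).
have kc := continuousMc (@continuous_expi_dotp R n (t^-1 *: x)) (schwartz_continuous ps).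
have kM := dominated_expi (dotp (t^-1 *: x)) hM.
have e : fourier (fun y => psi (t *: y)) x =
    (t ^- n)%:C * fourier psi (t^-1 *: x).
  rewrite -(integral_rV_scale t0 kc kM); congr integral_rV; apply/funext => y.
  by rewrite dotpZl dotpZr mulKf // gt_eqF.
by rewrite e mulrA -rmorphM divff ?mul1r // expf_neq0 // gt_eqF.
Qed.

Lemma Phi_multi_riesz n (beta : 'rV[R[i]]_n) phi :
  Phi_times phi -> Phi_times (multi_riesz beta phi).
Proof.
move=> [psi pP <-]; rewrite multi_riesz_fourier //.
by exists (fun x => multiplier beta x * psi x) => //; exact: Psi_multiplier.
Qed.

Lemma multi_riesz_surj n (beta : 'rV[R[i]]_n) phi : Phi_times phi ->
  exists2 phi', Phi_times phi' & multi_riesz beta phi' = phi.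
Proof.
move=> [psi pP <-]; have mP := Psi_multiplier (- beta) pP.
exists (fourier (fun x => multiplier (- beta) x * psi x)).
  by exists (fun x => multiplier (- beta) x * psi x).
rewrite multi_riesz_fourier //; congr fourier; apply/funext => x.
by rewrite mulrA multiplier_opp mul1r.
Qed.

Lemma PhiZ n c (phi : 'rV[R]_n -> R[i]) : Phi_times phi ->
  Phi_times (fun x => c * phi x).
Proof.
move=> [psi pP <-]; exists (fun x => c * psi x); first exact: PsiZ.
by apply: fourierZ; have [] := pP.
Qed.

Lemma Phi_dilation n (t : R) (phi : 'rV[R]_n -> R[i]) : 0 < t -> Phi_times phi ->
  Phi_times (fun x => phi (t^-1 *: x)).
Proof.
move=> t0 [psi pP <-]; rewrite fourier_scale //; last by have [] := pP.
apply: PhiZ; exists (fun y => psi (t *: y)) => //.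
by apply: Psi_scale => //; rewrite gt_eqF.
Qed.

(** Dilation by [1 / t] of a transform is dilation by [t] of [psi], on which the
multiplier acts with its degree of homogeneity. *)
Lemma multi_riesz_dilation n (beta : 'rV[R[i]]_n) (t : R) phi : 0 < t ->
  Phi_times phi ->
  multi_riesz beta (fun x => phi (t^-1 *: x)) =
  fun x => cpow t (\sum_(k < n) - beta 0 k) * multi_riesz beta phi (t^-1 *: x).
Proof.
move=> t0 [psi pP <-]; have [ps _] := pP; have t1 : t != 0 by rewrite gt_eqF.
have mP := Psi_multiplier beta pP; have [ms _] := mP.
have sP := Psi_scale t1 pP; have [ss _] := sP.
have [mss _] := Psi_scale t1 mP.
rewrite fourier_scale // -fourierZ // multi_riesz_fourier; last exact: PsiZ.
rewrite multi_riesz_fourier //.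
transitivity (fourier (fun x => cpow t (\sum_(k < n) - beta 0 k) *
    ((t ^+ n)%:C * (multiplier beta (t *: x) * psi (t *: x))))).
  congr fourier; apply/funext => x.
  by rewrite mulrCA (multiplier_scale beta x t0 pP) mulrCA.
rewrite fourierZ; last exact: schwartzZ.
apply/funext => x; rewrite (fourierZ _ mss); congr (_ * _).
by have /(congr1 (@^~ x)) /= <- := fourier_scale t0 ms.
Qed.

Lemma linear_on_PhiZ n (f : functional R n) c phi : linear_on_Phi f ->
  Phi_times phi -> f (fun x => c * phi x) = c * f phi.
Proof.
move=> fl pP; pose z (x : 'rV[R]_n) := 0 * phi x.
have zP : Phi_times z by exact: PhiZ.
have z0 x : z x = 0 by rewrite /z mul0r.
have fz : f z = 0.
  have := fl 1 z z zP zP; rewrite mul1r.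
  rewrite (_ : (fun x => _) = z); last by apply/funext => x; rewrite z0 mulr0 addr0.
  by move/eqP; rewrite -[X in X == _]addr0 (inj_eq (addrI _)) eq_sym => /eqP.
have := fl c phi z pP zP; rewrite fz addr0 => <-.
by congr f; apply/funext => x; rewrite z0 addr0.
Qed.

Lemma dual_dilation_multi_riesz n (beta : 'rV[R[i]]_n) (f : functional R n) (t : R)
    phi : linear_on_Phi f -> 0 < t -> Phi_times phi ->
  dual_dilation t (dual_multi_riesz beta f) phi =
  cpow t (\sum_(k < n) - beta 0 k) * dual_dilation t f (multi_riesz beta phi).
Proof.
move=> fl t0 pP; rewrite /dual_dilation /dual_multi_riesz.
rewrite multi_riesz_dilation // linear_on_PhiZ //; first by rewrite mulrCA.
by apply: Phi_dilation => //; exact: Phi_multi_riesz.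
Qed.

Lemma cvg_dual_multi_riesz n (beta : 'rV[R[i]]_n) (f : functional R n)
    (rho : R -> R) phi (l : R[i]) : linear_on_Phi f -> Phi_times phi ->
  ((dual_dilation t (dual_multi_riesz beta f) phi /
      (cpow t (\sum_(k < n) - beta 0 k) * (rho t)%:C) : R[i]^o) @[t --> +oo]
    --> (l : R[i]^o)) <->
  ((dual_dilation t f (multi_riesz beta phi) / (rho t)%:C : R[i]^o) @[t --> +oo]
    --> (l : R[i]^o)).
Proof.
move=> fl pP.
have E t : 0 < t -> dual_dilation t (dual_multi_riesz beta f) phi /
      (cpow t (\sum_(k < n) - beta 0 k) * (rho t)%:C) =
    dual_dilation t f (multi_riesz beta phi) / (rho t)%:C.
  move=> t0; rewrite dual_dilation_multi_riesz //.
  by rewrite -mulf_div divff ?mul1r // cpow_neq0.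
split; apply: cvg_trans; apply: near_eq_cvg; near=> t; rewrite E //;
  by near: t; exact: nbhs_pinfty_gt.
Unshelve. all: by end_near. Qed.

End RieszOnLizorkin.

Theorem theorem3p4 (R : realType) (n : nat) (n_gt0 : (0 < n)%N)
    (f : functional R n) (hf : Phi_dual f)
    (rho : R -> R) (hrho : automodel rho)
    (g : functional R n) (hg : Phi_dual g)
    (beta : 'rV[R[i]]_n) :
  quasi_asymptotic f g (fun t => (rho t)%:C) <->
  quasi_asymptotic (dual_multi_riesz beta f) (dual_multi_riesz beta g)
    (fun t => cpow t (\sum_(k < n) - beta 0 k) * (rho t)%:C).
Proof.
have [fl _] := hf.
split=> -[[phi0 p0 g0] lim]; split.
- have [phi1 p1 e] := multi_riesz_surj beta p0.
  by exists phi1 => //; rewrite /dual_multi_riesz e.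
- move=> phi pP; apply/cvg_dual_multi_riesz => //.
  by apply: lim; exact: Phi_multi_riesz.
- by exists (multi_riesz beta phi0) => //; exact: Phi_multi_riesz.
- move=> phi pP; have [phi1 p1 <-] := multi_riesz_surj beta pP.
  by apply/(cvg_dual_multi_riesz beta rho) => //; exact: lim.
Qed.
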